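(* For $\lambda=(\alpha+1|\alpha)$, $\lambda=(\alpha|\alpha+1)$ or $\lambda=(\alpha|\alpha)$, where $\lambda=(\lambda_1,\dots,\lambda_k)$, let $n_i=\lambda_i-i+1$ for $1\le i\le k$. The measures $\mathfrak{M}_{C}(\lambda)$, $\mathfrak{M}_{D}(\lambda)$ and $\mathfrak{M}_{B}(\lambda)$ are determinantal ensembles: $$\mathfrak{M}_{C}(\lambda)=\det\big(K_C(n_i,n_j)\big)_{1\leq i,j\leq k},\qquad \lambda=(\alpha+1|\alpha),$$ $$\mathfrak{M}_{D}(\lambda)=\det\big(K_D(n_i,n_j)\big)_{1\leq i,j\leq k},\qquad \lambda=(\alpha|\alpha+1),$$ $$\mathfrak{M}_{B}(\lambda)=\det\big(K_B(n_i,n_j)\big)_{1\leq i,j\leq k},\qquad \lambda=(\alpha|\alpha),$$ where the correlation kernels are given by the integrals $$K_C(a,b)=\int_{z}\int_{w}\frac{1-z^2}{(1-wz)(1-wz^{-1})}\frac{H(z)}{H(w)}\frac{dz\,dw}{(2\pi \mathbf{i})^2z^{b+1}w^{-a+1}},$$ $$K_D(a,b)=\int_{z}\int_{w}\frac{1-w^2}{(1-wz)(1-wz^{-1})}\frac{H(z)}{H(w)}\frac{dz\,dw}{(2\pi \mathbf{i})^2z^{b+1}w^{-a+1}},$$ $$K_B(a,b)=\int_{z}\int_{w}\frac{(1+z)(1-w)}{(1-wz)(1-wz^{-1})}\frac{J(z)}{J(w)}\frac{dz\,dw}{(2\pi \mathbf{i})^2z^{b+1}w^{-a+1}},$$ with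 $$H(z)=\prod^k_{i=1}(1-\mathbf{i}x_iz)(1-\mathbf{i}x_iz^{-1}),\qquad J(z)=\prod^k_{i=1}(1-x_iz)(1-x_iz^{-1}),$$ and the $z$- and $w$-contours are simple counterclockwise circles around $0$ satisfying $|w|<|z|<|x_i|$.
   Context: Here $\mathbf{i}=\sqrt{-1}$, while $i$ is an index, and $\mathbf{x}=(x_1,\dots,x_k)$ are variables. Partitions are written as $\lambda=(\lambda_1,\dots,\lambda_k)$, with zeros appended if necessary. Frobenius notation: for a partition $\lambda$ with conjugate $\lambda'$, the rank $\operatorname{rk}\lambda$ is the largest integer $r$ with $\lambda_r\ge r$, and $\lambda=(\alpha|\beta)=(\alpha_1,\dots,\alpha_r|\beta_1,\dots,\beta_r)$ with $r=\operatorname{rk}\lambda$, $\alpha_i=\lambda_i-i$, $\beta_i=\lambda'_i-i$; both $\alpha$ and $\beta$ are strictly decreasing sequences of nonnegative integers. $\alpha+1$ means $(\alpha_1+1,\dots,\alpha_r+1)$. The notation $\lambda=(\alpha+1|\alpha)$ means that $\lambda$ has this form for some such strict $\alpha$ (possibly empty); similarly for $(\alpha|\alpha+1)$ and $(\alpha|\alpha)$. $|\lambda|$ is the sum of the parts and $s_\lambda(\mathbf{x})$ is the Schur polynomial in $x_1,\dots,x_k$. The measures are $$\mathfrak{M}_{B}(\lambda)=\frac{(-1)^{\frac{|\lambda|+\operatorname{rk}\lambda}{2}} s_\lambda(\mathbf{x})}{\prod^k_{i=1}(1-x_i)\prod_{1 \leq i< j \leq k}(1-x_ix_j)}\quad(\lambda=(\alpha|\alpha)),$$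 $$\mathfrak{M}_{C}(\lambda)=\frac{s_{\lambda}(\mathbf{x})}{\prod_{1 \leq i\leq j \leq k}(1+x_ix_j)}\quad(\lambda=(\alpha+1|\alpha)),\qquad \mathfrak{M}_{D}(\lambda)=\frac{s_{\lambda}(\mathbf{x})}{\prod_{1 \leq i< j \leq k}(1+x_ix_j)}\quad(\lambda=(\alpha|\alpha+1)).$$
   Formalization: As printed the claim is false (k=1, λ=∅). The contours |w|<|z|<|x_i| are replaced by circles with |x_i|<|w|<|z| and |wz|<1 (so |x_i|<1), and the numerator (1+z)(1−w) of K_B is replaced by (1−z)(1+w). *)

(* Defs.v *)
From HB Require Import structures.
From mathcomp Require Import all_boot all_order all_algebra.
From mathcomp Require Import all_classical all_reals all_analysis.
From mathcomp Require Import complex.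

Set Implicit Arguments.
Unset Strict Implicit.
Unset Printing Implicit Defensive.

Import Order.TTheory GRing.Theory Num.Theory.
Import numFieldNormedType.Exports.

Local Open Scope ring_scope.
Local Open Scope complex_scope.

(* Partitions are weakly decreasing sequences of naturals, trailing zeros being
   allowed; rows and columns are numbered from 0, so that the i-th part in the
   usual numbering is [nth 0 lam i.-1]. *)
Section Partitions.
Local Open Scope nat_scope.
Implicit Type lam : seq nat.

Definition conj_part lam (j : nat) : nat := count (fun m => j < m) lam.

Definition frob_rank lam : nat :=
  \max_(i < size lam | i < nth 0 lam i) i.+1.

(* The truncated subtractions are exact, because i < frob_rank lam. *)
Definition frobenius lam : seq nat * seq nat :=
  (mkseq (fun i => nth 0 lam i - i.+1) (frob_rank lam),
   mkseq (fun i => conj_part lam i - i.+1) (frob_rank lam)).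

Definition typeC lam : Prop :=
  exists2 alpha : seq nat, sorted gtn alpha &
    frobenius lam = (map S alpha, alpha).

Definition typeD lam : Prop :=
  exists2 alpha : seq nat, sorted gtn alpha &
    frobenius lam = (alpha, map S alpha).

Definition typeB lam : Prop :=
  exists2 alpha : seq nat, sorted gtn alpha &
    frobenius lam = (alpha, alpha).

Definition cell lam : finType :=
  {c : 'I_(size lam) * 'I_(head 0 lam) | c.2 < nth 0 lam c.1}.

Definition semistandard lam k (T : {ffun cell lam -> 'I_k}) : bool :=
  [forall c : cell lam, forall d : cell lam,
     (((val c).1 == (val d).1) && ((val c).2 <= (val d).2) ==> (T c <= T d))
  && (((val c).2 == (val d).2) && ((val c).1 < (val d).1) ==> (T c < T d))].

End Partitions.

Definition schur (A : comNzRingType) (k : nat) (lam : seq nat) (x : 'I_k -> A)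
    : A :=
  \sum_(T : {ffun cell lam -> 'I_k} | semistandard T) \prod_(c : cell lam) x (T c).

Section Measures.
Variables (F : fieldType) (k : nat).
Implicit Types (lam : seq nat) (x : 'I_k -> F).

Definition frakM_B x lam : F :=
  (-1) ^+ ((sumn lam + frob_rank lam) %/ 2) * schur lam x
  / ((\prod_(i < k) (1 - x i))
     * \prod_(i < k) \prod_(j < k | (i < j)%N) (1 - x i * x j)).

Definition frakM_C x lam : F :=
  schur lam x / \prod_(i < k) \prod_(j < k | (i <= j)%N) (1 + x i * x j).

Definition frakM_D x lam : F :=
  schur lam x / \prod_(i < k) \prod_(j < k | (i < j)%N) (1 + x i * x j).

End Measures.

Section Kernels.
Variable R : realType.
Implicit Types (r : R) (z w : R[i]) (a b : int).

Definition complex_integral (D : set R) (f : R -> R[i]) : R[i] :=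
  (\int[lebesgue_measure]_(t in D) complex.Re (f t))
  +i* (\int[lebesgue_measure]_(t in D) complex.Im (f t)).

Definition circle_pt r (t : R) : R[i] := (r * cos t) +i* (r * sin t).

(* The counterclockwise integral of f over |z| = r, with dz = 'i z dt. *)
Definition circle_integral r (f : R[i] -> R[i]) : R[i] :=
  complex_integral `[0, 2 * pi]%classic
    (fun t => f (circle_pt r t) * ('i%C * circle_pt r t)).

Variable k : nat.
Implicit Type x : 'I_k -> R[i].

Definition Hfun x z : R[i] :=
  \prod_(i < k) ((1 - 'i%C * x i * z) * (1 - 'i%C * x i * z^-1)).

Definition Jfun x z : R[i] :=
  \prod_(i < k) ((1 - x i * z) * (1 - x i * z^-1)).

(* In the three kernels the z-circle has radius rz and the w-circle radius rw. *)
Definition kernelC x (rz rw : R) a b : R[i] :=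
  circle_integral rz (fun z => circle_integral rw (fun w =>
    (1 - z ^+ 2) / ((1 - w * z) * (1 - w * z^-1)) * (Hfun x z / Hfun x w)
    / ((2 * pi%:C * 'i%C) ^+ 2 * z ^ (b + 1) * w ^ (- a + 1)))).

Definition kernelD x (rz rw : R) a b : R[i] :=
  circle_integral rz (fun z => circle_integral rw (fun w =>
    (1 - w ^+ 2) / ((1 - w * z) * (1 - w * z^-1)) * (Hfun x z / Hfun x w)
    / ((2 * pi%:C * 'i%C) ^+ 2 * z ^ (b + 1) * w ^ (- a + 1)))).

(* With (1 + z) (1 - w) in place of (1 - z) (1 + w) the determinant would be
   the measure at -x: for k = 1 and the empty partition, 1 / (1 + x 0). *)
Definition kernelB x (rz rw : R) a b : R[i] :=
  circle_integral rz (fun z => circle_integral rw (fun w =>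
    (1 - z) * (1 + w) / ((1 - w * z) * (1 - w * z^-1)) * (Jfun x z / Jfun x w)
    / ((2 * pi%:C * 'i%C) ^+ 2 * z ^ (b + 1) * w ^ (- a + 1)))).

(* The w-circle surrounds the poles 'i x_i (x_i for kernelB) of the integrand
   but none of the poles z, 1/z and 1/('i x_i) (1/x_i for kernelB); the
   conditions force |x_i| < 1.  If it surrounded none of its poles, the zero of
   order k of H (or J)^-1 at the origin would make the kernels vanish at all
   the points needed. *)
Definition admissible_contours x (rz rw : R) : Prop :=
  [/\ 0 < rw, rw < rz, rz * rw < 1 & forall i : 'I_k, `|x i| < rw%:C].

End Kernels.

Definition npos (lam : seq nat) (i : nat) : int := (nth 0%N lam i)%:Z - i%:Z.

(* Main.v *)
Require Import Defs.
From mathcomp Require Import all_boot all_order all_algebra.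
From mathcomp Require Import all_classical all_reals all_analysis.
From mathcomp Require Import complex.
From mathcomp Require Import fingroup perm ring zify.

(** Write y = i x for types C and D and y = x for type B, P = prod (w - y_p),
Q = prod (1 - y_p w), S = z + 1/z.  Up to a factor N1(z) N2(w), the kernel is
the coefficient of z^b in J(z) I_w(w g(w) / (P Q (1 - w z) (1 - w / z))) with
g = w^(a + k - 1), where I_w is the mean over the circle |w| = rw.  This mean
vanishes on multiples of P, hence only depends on the coordinates of g in the
Newton basis g_i = prod_(p < i) (w - y_p) modulo P, and on Q g_i it is an
explicit polynomial c_i(S).  The kernel matrix is thus a product of square
matrices: the Newton coordinates of the powers w^(lam_i + k - 1 - i), whose
determinant obeys the branching rule of Schur polynomials; the inverse of the
multiplication by Q, triangular in the Newton basis; the coefficients of the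
c_i, whose determinant is prod_(p < q) (1 - y_p y_q); and the coefficients of
z^(n_j) in the powers of S.  In the last factor the columns are symmetric or
antisymmetric under a reflection b -> c - b, and the Frobenius condition says
that this reflection, applied to the outer hook, replaces the positions n_j of
lam by those of lam with its outer hook removed; down to the empty partition
this leaves a unitriangular matrix and a sign.  Newton coordinates avoid
divided Vandermonde quotients, so that equal or vanishing x_p need no limit. *)

Set Implicit Arguments.
Unset Strict Implicit.
Unset Printing Implicit Defensive.

Import Order.TTheory GRing.Theory Num.Theory.
Import numFieldNormedType.Exports.

Local Open Scope classical_set_scope.
Local Open Scope ring_scope.
Local Open Scope complex_scope.

(** * Newton coordinates *)

Section NewtonBasis.
Variable F : fieldType.
Implicit Types (ys : seq F) (f g : {poly F}).

Definition newton ys (i : nat) : {poly F} := \prod_(y <- take i ys) ('X - y%:P).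

Fixpoint divdiff ys f (m : nat) : F :=
  if ys is y :: ys' then
    if m is m'.+1 then divdiff ys' (f %/ ('X - y%:P)) m' else f.[y]
  else 0.

Lemma newton0 ys : newton ys 0 = 1.
Proof. by rewrite /newton take0 big_nil. Qed.

Lemma newtonS y ys i : newton (y :: ys) i.+1 = ('X - y%:P) * newton ys i.
Proof. by rewrite /newton /= big_cons. Qed.

Lemma divdiffD ys f g m : divdiff ys (f + g) m = divdiff ys f m + divdiff ys g m.
Proof.
elim: ys f g m => [|y ys IH] f g [|m] /=; rewrite ?addr0//.
  by rewrite hornerD.
by rewrite divpD IH.
Qed.

Lemma divdiffZ ys c f m : divdiff ys (c *: f) m = c * divdiff ys f m.
Proof.
elim: ys f m => [|y ys IH] f [|m] /=; rewrite ?mulr0//.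
  by rewrite hornerZ.
by rewrite divpZl IH.
Qed.

Lemma divdiff0 ys m : divdiff ys 0 m = 0.
Proof. by rewrite -(scale0r 0) divdiffZ mul0r. Qed.

Lemma divdiff_sum ys (I : Type) (s : seq I) (P : pred I) (f : I -> {poly F}) m :
  divdiff ys (\sum_(i <- s | P i) f i) m = \sum_(i <- s | P i) divdiff ys (f i) m.
Proof.
elim: s => [|i s IH]; first by rewrite !big_nil divdiff0.
by rewrite !big_cons; case: (P i) => //; rewrite divdiffD IH.
Qed.

Lemma newton_expansion ys f : exists q,
  f = \sum_(i < size ys) divdiff ys f i *: newton ys i + newton ys (size ys) * q.
Proof.
elim: ys f => [|y ys IH] f.
  by exists f; rewrite big_ord0 newton0 mul1r add0r.
have [q Hq] := IH (f %/ ('X - y%:P)); exists q.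
rewrite [size _]/= big_ord_recl newtonS newton0.
under eq_bigr => i _ do rewrite newtonS [divdiff _ _ _]/= scalerAr.
rewrite -mulr_sumr -addrA -mulrA -mulrDr -Hq /=.
by rewrite {1}(divp_eq f ('X - y%:P)) modp_XsubC addrC alg_polyC mulrC.
Qed.

Lemma divdiff_newton_lt ys i m f : (m < i)%N -> (m < size ys)%N ->
  divdiff ys (f * newton ys i) m = 0.
Proof.
elim: ys i m f => [|y ys IH] [|i] [|m] f //=; rewrite newtonS mulrCA.
  by rewrite hornerM hornerXsubC subrr mul0r.
by rewrite !ltnS mulKp ?polyXsubC_eq0//; exact: IH.
Qed.

Lemma divdiff_newton_diag ys m f : (m < size ys)%N ->
  divdiff ys (f * newton ys m) m = f.[ys`_m].
Proof.
elim: ys m f => [|y ys IH] [|m] f //=; first by rewrite newton0 mulr1.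
by rewrite newtonS mulrCA ltnS mulKp ?polyXsubC_eq0//; exact: IH.
Qed.

Lemma divdiff_mul ys f g m : (m < size ys)%N ->
  divdiff ys (f * g) m
  = \sum_(i < size ys) divdiff ys g i * divdiff ys (f * newton ys i) m.
Proof.
move=> hm; have [q Hq] := newton_expansion ys g.
rewrite {1}Hq mulrDr divdiffD mulrCA [newton _ _ * _]mulrC divdiff_newton_lt// addr0.
rewrite mulr_sumr divdiff_sum; apply: eq_bigr => i _.
by rewrite -scalerAr divdiffZ.
Qed.

Definition mul_mx n ys f : 'M[F]_n := \matrix_(i, j) divdiff ys (f * newton ys i) j.

Lemma det_mul_mx n ys f : size ys = n -> \det (mul_mx n ys f) = \prod_(y <- ys) f.[y].
Proof.
move=> hs; rewrite -det_tr det_trig.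
  rewrite (big_nth 0) hs big_mkord; apply: eq_bigr => i _.
  by rewrite !mxE divdiff_newton_diag ?hs.
apply/is_trig_mxP => i j ij.
by rewrite !mxE divdiff_newton_lt ?hs ?ltn_ord.
Qed.

Definition power_mx n ys (lam : seq nat) : 'M[F]_n :=
  \matrix_(i, j) divdiff ys 'X^(nth 0%N lam i + (n.-1 - i)) j.

Lemma divp_geometric (y : F) a d :
  ('X^(a + d) - y ^+ d *: 'X^a) %/ ('X - y%:P)
  = \sum_(m < d) y ^+ m *: 'X^(a + (d.-1 - m)).
Proof.
have -> : 'X^(a + d) - y ^+ d *: 'X^a = 'X^a * ('X^d - y%:P ^+ d) :> {poly F}.
  by rewrite mulrBr -exprD -polyC_exp -mul_polyC [_%:P * _]mulrC.
rewrite subrXX mulrCA mulKp ?polyXsubC_eq0// mulr_sumr.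
by apply: eq_bigr => m _; rewrite -polyC_exp mulrA -exprD mulrC mul_polyC.
Qed.

Lemma sum_interval_rev (V : nmodType) (g : nat -> V) (a b N : nat) :
  (b <= a)%N -> (a < N)%N ->
  \sum_(m < (a - b).+1) g (a - m)%N = \sum_(m < N | (b <= m <= a)%N) g m.
Proof.
move=> ba aN.
have -> : \sum_(m < N | (b <= m <= a)%N) g m = \sum_(b <= m < a.+1) g m.
  rewrite -(big_mkord (fun m => b <= m <= a)%N g) (big_cat_nat (n := a.+1))//=.
  rewrite [X in _ + X]big_nat_cond [X in _ + X]big_pred0 ?addr0 => [|i]; last first.
    by lia.
  rewrite [RHS](big_nat_widenl _ 0%N)// big_nat_cond [RHS]big_nat_cond.
  by apply: eq_bigl => i; rewrite ltnS; case: (i <= a)%N; rewrite ?andbF ?andbT.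
rewrite (reindex_inj rev_ord_inj) /= -[X in \sum_(X <= _ < _) _]add0n big_addn subSn// big_mkord.
by apply: eq_bigr => i _; congr g; have := ltn_ord i; lia.
Qed.

Lemma det_sum_rows (R : comNzRingType) n N (P : 'I_n -> pred 'I_N)
    (c : 'I_n -> 'I_N -> R) (v : 'I_n -> 'I_N -> 'rV[R]_n) :
  \det (\matrix_(i, j) \sum_(m | P i m) c i m * v i m 0 j)
  = \sum_(f : {ffun 'I_n -> 'I_N} | [forall i, P i (f i)])
      (\prod_i c i (f i)) * \det (\matrix_(i, j) v i (f i) 0 j).
Proof.
rewrite [LHS](eq_bigr (fun s : 'S_n => \sum_(f : {ffun 'I_n -> 'I_N} | [forall i, P i (f i)])
   (-1) ^+ s * \prod_i (c i (f i) * v i (f i) 0 (s i)))); last first.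
  move=> s _; under eq_bigr do rewrite mxE.
  rewrite bigA_distr_big_dep /= mulr_sumr; apply: eq_bigl => f.
  by apply/familyP/forallP.
rewrite exchange_big; apply: eq_bigr => f _.
rewrite /determinant mulr_sumr; apply: eq_bigr => s _.
by rewrite big_split mulrCA; under [X in _ = _ * (_ * X)]eq_bigr do rewrite mxE.
Qed.

Definition interlacing n N (lam : seq nat) (f : {ffun 'I_n -> 'I_N}) :=
  [forall i : 'I_n, nth 0%N lam i.+1 <= f i <= nth 0%N lam i]%N.

Definition ffun_parts n N (f : {ffun 'I_n -> 'I_N}) : seq nat :=
  [seq nat_of_ord (f i) | i <- enum 'I_n].

Lemma nth_ffun_parts n N (f : {ffun 'I_n -> 'I_N}) (i : 'I_n) :
  nth 0%N (ffun_parts f) i = f i.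
Proof. by rewrite (nth_map i) ?size_enum_ord// nth_ord_enum. Qed.

Lemma power_mx_branching n (y : F) ys (lam : seq nat) :
  (forall i, (i < n)%N -> nth 0 lam i.+1 <= nth 0 lam i)%N ->
  \det (power_mx n.+1 (y :: ys) lam) =
  (-1) ^+ n * (y ^+ nth 0%N lam n *
  \sum_(f : {ffun 'I_n -> 'I_(head 0%N lam).+1} | interlacing lam f)
     (\prod_(i < n) y ^+ (nth 0%N lam i - f i)) * \det (power_mx n ys (ffun_parts f))).
Proof.
move=> hlam.
pose l i := (nth 0 lam i + (n - i))%N.
pose d i := (nth 0 lam i - nth 0 lam i.+1).+1%N.
have ld i : (i < n)%N -> l i = (l i.+1 + d i)%N.
  by move=> i_n; have := hlam i i_n; rewrite /l /d; lia.
pose L : 'M[F]_n.+1 := \matrix_(i, j)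
  ((i == j)%:R - (i.+1 == j :> nat)%:R * y ^+ d i).
have detL : \det L = 1.
  rewrite -det_tr det_trig.
    rewrite big1// => i _; rewrite !mxE eqxx (_ : _ == _ :> nat = false) ?mul0r ?subr0//.
    by apply/negbTE; lia.
  apply/is_trig_mxP => i j ij; rewrite !mxE.
  have -> : (j == i) = false by apply/negbTE; rewrite -val_eqE /=; lia.
  have -> : (j.+1 == i :> nat) = false by apply/negbTE; lia.
  by rewrite mul0r subr0.
have LU (i : 'I_n.+1) j : (L *m power_mx n.+1 (y :: ys) lam) i j =
   if (i < n)%N then divdiff (y :: ys) ('X^(l i) - y ^+ d i *: 'X^(l i.+1)) j
   else divdiff (y :: ys) 'X^(l i) j.
  rewrite mxE; under eq_bigr do rewrite mxE mulrBl.
  rewrite big_split /= sumrN (bigD1 i)//= eqxx mul1r [X in _ + X - _]big1 ?addr0; last first.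
    by move=> p /negbTE; rewrite eq_sym => ->; rewrite mul0r.
  rewrite mxE; case: ltnP => hi; last first.
    rewrite big1 ?subr0// => p _; rewrite (_ : _ == _ :> nat = false) ?mul0r//.
    by apply/negbTE; have := ltn_ord p; lia.
  rewrite (bigD1 (Ordinal (hi : i.+1 < n.+1)%N))//= eqxx mul1r big1 ?addr0; last first.
    move=> p; rewrite -val_eqE /= eq_sym => /negbTE hp.
    by rewrite hp !mul0r.
  by rewrite mxE -scaleNr -[RHS]/(divdiff (y :: ys) _ j) divdiffD divdiffZ mulNr.
rewrite -[LHS]mul1r -[X in X * _]detL -det_mulmx (expand_det_col _ ord0).
rewrite big_ord_recr big1 ?add0r => [|i _]; last first.
  rewrite LU /= ltn_ord /= ld// hornerD hornerN hornerZ !hornerXn exprD.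
  by rewrite [y ^+ l _ * _]mulrC subrr mul0r.
rewrite LU /= ltnn hornerXn {1}/l subnn addn0 /cofactor addn0 add0r mulrCA.
congr (_ * (_ * _)).
set M := row' _ _.
have -> : M = \matrix_(i, j) \sum_(m : 'I_(head 0%N lam).+1 |
    (nth 0 lam i.+1 <= m <= nth 0 lam i)%N)
    y ^+ (nth 0%N lam i - m) *
    (\row_j divdiff ys 'X^(m + (n.-1 - i)) j : 'rV[F]_n) 0 j.
  apply/matrixP => i j; rewrite [RHS]mxE.
  transitivity ((L *m power_mx n.+1 (y :: ys) lam) (lift ord_max i) (lift ord0 j)).
    by rewrite /M !mxE.
  rewrite LU lift_max ltn_ord ld// lift0 /= divp_geometric divdiff_sum.
  pose g m := y ^+ (nth 0%N lam i - m) * divdiff ys 'X^(m + (n.-1 - i)) j.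
  rewrite [RHS](eq_bigr (fun m : 'I_(head 0%N lam).+1 => g m)); last first.
    by move=> m _; rewrite mxE.
  have lam_head p : (p <= n)%N -> (nth 0 lam p <= head 0 lam)%N.
    elim: p => [|p IHp] hp; first by rewrite nth0.
    by rewrite (leq_trans (hlam _ hp))// IHp// ltnW.
  rewrite -[RHS](@sum_interval_rev _ g (nth 0%N lam i) (nth 0%N lam i.+1)).
  - apply: eq_bigr => m _; rewrite divdiffZ /g.
    have h3 : (m < (nth 0 lam i - nth 0 lam i.+1).+1)%N := ltn_ord m.
    have h2 := hlam i (ltn_ord i); have h1 : (i < n)%N := ltn_ord i.
    have aux (p q a c : nat) : (c < n)%N -> (q <= p)%N -> (a < (p - q).+1)%N ->
        (a = p - (p - a))%N /\
        (q + (n - c.+1) + ((p - q).+1.-1 - a) = p - a + (n.-1 - c))%N by lia.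
    by have [e1 e2] := aux _ _ _ _ h1 h2 h3; rewrite {1}e1 -e2.
  - exact: hlam.
  - by rewrite ltnS lam_head// ltnW.
rewrite det_sum_rows; apply: eq_bigr => f _; congr (_ * \det _).
by apply/matrixP => i j; rewrite !mxE nth_ffun_parts.
Qed.

End NewtonBasis.

Section Resultants.
Variable F : fieldType.
Implicit Types (ys : seq F) (p : {poly F}) (y z : F).

Definition hpoly y : {poly F} := (1 + y ^+ 2)%:P - y *: 'X.

(* If [(A, B) = redpair ys] then [prod (w - y) = A w - B] modulo
   [w^2 = 'X w - 1]. *)
Fixpoint redpair ys : {poly F} * {poly F} :=
  if ys is y :: ys' then
    (('X - y%:P) * (redpair ys').1 - (redpair ys').2,
     (redpair ys').1 - y *: (redpair ys').2)
  else (0, -1).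

Lemma redpair_cons y ys : redpair (y :: ys) =
  (('X - y%:P) * (redpair ys).1 - (redpair ys).2, (redpair ys).1 - y *: (redpair ys).2).
Proof. by []. Qed.

Lemma size_redpair ys :
  (size (redpair ys).1 <= size ys)%N /\ (size (redpair ys).2 <= (size ys).+1)%N.
Proof.
elim: ys => [|y ys [IH1 IH2]] /=; first by rewrite size_poly0 size_polyN size_poly1.
split.
  rewrite (leq_trans (size_polyD _ _))// size_polyN geq_max IH2 andbT.
  have [->|A0] := eqVneq (redpair ys).1 0; first by rewrite mulr0 size_poly0.
  by rewrite size_proper_mul ?size_XsubC ?lead_coefXsubC ?mul1r ?lead_coef_eq0.
rewrite (leq_trans (size_polyD _ _))// size_polyN geq_max.
apply/andP; split; first by apply: leq_trans IH1 _; apply: leqW.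
by apply: leq_trans (size_scale_leq _ _) _; apply: leq_trans IH2 _.
Qed.

(* [z^n p((1 + z^2) / z)], made meaningful at [z = 0]. *)
Definition homev n z p : F := \sum_(j < n.+1) p`_j * (1 + z ^+ 2) ^+ j * z ^+ (n - j).

Lemma homevD n z p q : homev n z (p + q) = homev n z p + homev n z q.
Proof. by rewrite -big_split; apply: eq_bigr => j _; rewrite coefD !mulrDl. Qed.

Lemma homevZ n z c p : homev n z (c *: p) = c * homev n z p.
Proof. by rewrite mulr_sumr; apply: eq_bigr => j _; rewrite coefZ !mulrA. Qed.

Lemma homevB n z p q : homev n z (p - q) = homev n z p - homev n z q.
Proof. by rewrite -scaleN1r homevD homevZ mulN1r. Qed.

Lemma homevS n z p : (size p <= n.+1)%N -> homev n.+1 z p = z * homev n z p.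
Proof.
move=> sp; rewrite /homev big_ord_recr /= nth_default// !mul0r addr0 mulr_sumr.
apply: eq_bigr => j _; have jn : (j <= n)%N by rewrite -ltnS.
by rewrite subSn// [X in _ * X = _]exprS mulrCA.
Qed.

Lemma homevXM n z p : homev n.+1 z ('X * p) = (1 + z ^+ 2) * homev n z p.
Proof.
rewrite /homev big_ord_recl coefXM !mul0r add0r mulr_sumr.
by apply: eq_bigr => j _; rewrite coefXM /= [X in _ * X * _]exprS !mulrA [_ * (1 + z ^+ 2)]mulrC.
Qed.

Lemma homev_hpoly n y p : (size p <= n)%N -> homev n y (hpoly y * p) = 0.
Proof.
case: n => [|n] sp.
  move: sp; rewrite leqn0 size_poly_eq0 => /eqP ->.
  by rewrite mulr0 -(scale0r 0) homevZ mul0r.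
rewrite /hpoly mulrBl -scalerAl homevB mul_polyC !homevZ homevXM homevS//.
ring.
Qed.

Lemma homev_redpair z y ys :
  let A := homev (size ys) z (redpair (y :: ys)).1 in
  let B := homev (size ys).+1 z (redpair (y :: ys)).2 in
  A - B = \prod_(v <- y :: ys) (1 - v * z) /\
  z ^+ 2 * A - B = z ^+ (size ys).+1 * \prod_(v <- y :: ys) (z - v).
Proof.
elim: ys y => [|y' ys IH] y.
  rewrite /= !big_seq1 mulr0 sub0r opprK scalerN sub0r opprK alg_polyC.
  rewrite /homev !big_ord_recl !big_ord0 /= !coefC /=.
  by rewrite !subn0 !expr0; split; ring.
have [] := IH y'; rewrite [redpair [:: y, y' & ys]]redpair_cons.
have [] := size_redpair (y' :: ys); move: (redpair (y' :: ys)) => [A B] /= sA sB.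
move=> IH1 IH2.
rewrite [\prod_(v <- [:: y, y' & ys]) (1 - _)]big_cons -IH1.
rewrite [\prod_(v <- [:: y, y' & ys]) (z - _)]big_cons exprS.
rewrite [_ * (_ * \prod_(v <- _) _)]mulrACA -IH2.
rewrite mulrBl mul_polyC !homevB homevXM !homevZ.
rewrite [homev _.+2 z A]homevS; last exact: leqW.
rewrite [homev _.+2 z B]homevS// [homev _.+1 z A]homevS//.
by split; ring.
Qed.

Lemma homev_redpair_head y ys : 1 - y ^+ 2 != 0 ->
  homev (size ys) y (redpair (y :: ys)).1 = \prod_(v <- ys) (1 - y * v).
Proof.
move=> y1; have [] := homev_redpair y y ys.
rewrite !big_cons subrr mul0r mulr0 => e1 e2; apply: (mulfI y1).
have -> : \prod_(v <- ys) (1 - y * v) = \prod_(v <- ys) (1 - v * y).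
  by apply: eq_bigr => v _; rewrite mulrC.
by rewrite expr2 -e1 -[LHS]addr0 -[X in _ = X]subr0 -[X in _ = _ - X]e2; ring.
Qed.

Definition cpoly ys i : {poly F} :=
  (\prod_(y <- take i ys) hpoly y) * (redpair (drop i ys)).1.

Lemma size_cpoly ys i : (i <= size ys)%N -> (size (cpoly ys i) <= size ys)%N.
Proof.
elim: ys i => [|y ys IH] [|i] hi; rewrite /cpoly ?take0 ?drop0 ?big_nil ?mul1r //.
- by case: (size_redpair [::]).
- by case: (size_redpair (y :: ys)).
rewrite /= big_cons -mulrA -/(cpoly ys i) (leq_trans (size_polyMleq _ _))//.
have hh : (size (hpoly y) <= 2)%N.
  rewrite (leq_trans (size_polyD _ _))// size_polyN geq_max.
  rewrite (leq_trans (size_polyC_leq1 _))//=.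
  by rewrite (leq_trans (size_scale_leq _ _))// size_polyX.
apply: (leq_trans (n := (2 + size ys).-1)) => //.
by rewrite -!subn1 leq_sub2r// leq_add// IH.
Qed.

Definition cpoly_mx n ys : 'M[F]_n := \matrix_(i, j) (cpoly ys i)`_j.

Fixpoint pair_prod ys : F :=
  if ys is y :: ys' then (\prod_(v <- ys') (1 - y * v)) * pair_prod ys' else 1.

(* Replacing the last column by the homogeneous evaluations at [y] annihilates
   all the rows but the first, since they are multiples of [hpoly y]. *)
Lemma det_cpoly_mx n ys : size ys = n ->
  all (fun y => (1 + y ^+ 2 != 0) && (1 - y ^+ 2 != 0)) ys ->
  \det (cpoly_mx n ys) = (\prod_(j < n) (-1) ^+ j) * pair_prod ys.
Proof.
elim: ys n => [|y ys IH] [|n]// => [_ _|]; first by rewrite det_mx00 big_ord0 mul1r.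
case=> hs /andP[/andP[y1 y2] hys].
pose t (i : nat) := (1 + y ^+ 2) ^+ i * y ^+ (n - i).
pose E : 'M[F]_n.+1 := \matrix_(i, j) if j == ord_max then t i else (i == j)%:R.
have detE : \det E = (1 + y ^+ 2) ^+ n.
  rewrite -det_tr det_trig.
    rewrite big_ord_recr big1 ?mul1r => [|i _].
      by rewrite !mxE eqxx /t /= subnn mul1r expr0 mulr1.
    rewrite !mxE eqxx; case: eqP => // /(congr1 val) /= e.
    by have := ltn_ord i; rewrite e ltnn.
  apply/is_trig_mxP => i j ij; rewrite !mxE.
  case: eqP => [/(congr1 val) /= e|_].
    by have := leq_trans ij (leq_ord j); rewrite e ltnn.
  by rewrite -val_eqE /= gtn_eqF.
pose B : 'M[F]_n := \matrix_(l, j) ((l == j)%:R * (1 + y ^+ 2) - (l.+1 == j :> nat)%:R * y).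
have detB : \det B = (1 + y ^+ 2) ^+ n.
  rewrite -det_tr det_trig.
    under eq_bigr => i _ do rewrite !mxE eqxx mul1r gtn_eqF// mul0r subr0.
    by rewrite prodr_const card_ord.
  apply/is_trig_mxP => i j ij; rewrite !mxE -val_eqE /= gtn_eqF// gtn_eqF.
    by rewrite !mul0r subr0.
  by rewrite ltnS ltnW.
have ME (i : 'I_n.+1) : (cpoly_mx n.+1 (y :: ys) *m E) i ord_max
    = homev n y (cpoly (y :: ys) i).
  by rewrite mxE; apply: eq_bigr => j _; rewrite !mxE eqxx mulrA.
have ME' (i : 'I_n.+1) (j : 'I_n) : (cpoly_mx n.+1 (y :: ys) *m E) i (lift ord_max j)
    = (cpoly (y :: ys) i)`_j.
  rewrite mxE (bigD1 (lift ord_max j))//= big1 ?addr0.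
    by rewrite !mxE eqxx eq_sym (negbTE (neq_lift _ _)) mulr1 lift_max.
  by move=> l /negbTE hl; rewrite !mxE hl eq_sym (negbTE (neq_lift _ _)) mulr0.
apply: (@mulIf _ ((1 + y ^+ 2) ^+ n)); first by rewrite expf_neq0.
rewrite -{1}detE -det_mulmx (expand_det_col _ ord_max) [LHS]big_ord_recl.
rewrite [X in _ + X = _]big1 ?addr0; last first.
  move=> i _; rewrite ME lift0 /cpoly /= big_cons -mulrA -/(cpoly ys i).
  by rewrite homev_hpoly ?mul0r// -[X in (_ <= X)%N]hs size_cpoly// hs ltnW.
have -> : (cpoly_mx n.+1 (y :: ys) *m E) ord0 ord_max = \prod_(v <- ys) (1 - y * v).
  rewrite ME /cpoly take0 drop0 big_nil mul1r -homev_redpair_head//.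
  by rewrite hs.
rewrite /cofactor add0n.
have -> : row' ord0 (col' ord_max (cpoly_mx n.+1 (y :: ys) *m E)) = cpoly_mx n ys *m B.
  apply/matrixP => i j; rewrite [LHS]mxE [LHS]mxE ME' mxE.
  rewrite lift0 /cpoly /= big_cons -mulrA -/(cpoly ys i) /hpoly mulrBl -scalerAl.
  rewrite coefB coefCM coefZ coefXM.
  under eq_bigr do rewrite !mxE mulrBr.
  rewrite big_split /= sumrN; congr (_ - _).
    rewrite (bigD1 j)//= eqxx mul1r big1 ?addr0 1?mulrC// => l /negbTE ->.
    by rewrite mul0r mulr0.
  case: (posnP j) => [->|j0].
    by rewrite mulr0 big1// => l _; rewrite mul0r mulr0.
  have hj : (j.-1 < n)%N by rewrite (leq_ltn_trans (leq_pred _)).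
  rewrite (bigD1 (Ordinal hj))//= prednK// eqxx mul1r big1 ?addr0.
    by rewrite mulrC.
  move=> l; rewrite -val_eqE /= => /negbTE hl.
  by rewrite -[X in _ == X](prednK j0) eqSS hl mul0r mulr0.
rewrite det_mulmx detB IH//.
by rewrite big_ord_recr /=; ring.
Qed.

End Resultants.

(** * Semistandard tableaux *)

Section Tableaux.
Local Open Scope nat_scope.
Implicit Types (lam mu : seq nat).

Definition weakly_decreasing lam := forall i, nth 0 lam i.+1 <= nth 0 lam i.

Lemma weakly_decreasing_nth lam i j : weakly_decreasing lam -> i <= j ->
  nth 0 lam j <= nth 0 lam i.
Proof.
move=> dl /subnK <-; elim: (j - i) => // d IH.
by rewrite addSn (leq_trans (dl _)).
Qed.

Lemma sorted_weakly_decreasing lam : sorted geq lam -> weakly_decreasing lam.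
Proof.
move=> sl i; case: (ltnP i.+1 (size lam)) => hi; last by rewrite (nth_default _ hi).
by move/(sortedP 0): sl => /(_ i hi).
Qed.

Definition cell_row lam (c : cell lam) : nat := (val c).1.
Definition cell_col lam (c : cell lam) : nat := (val c).2.

Lemma cell_lt lam (c : cell lam) : (cell_col c) < nth 0 lam (cell_row c).
Proof. exact: (valP c). Qed.

Lemma cell_at lam i j : weakly_decreasing lam -> j < nth 0 lam i ->
  exists c : cell lam, (cell_row c) = i /\ (cell_col c) = j.
Proof.
move=> dl ij.
have hi : i < size lam.
  by rewrite ltnNge; apply: contraL ij => hi; rewrite nth_default.
have hj : j < head 0 lam.
  by rewrite -nth0 (leq_trans ij)// weakly_decreasing_nth.
by exists (exist _ (Ordinal hi, Ordinal hj) ij : cell lam).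
Qed.

Lemma cell_inj lam (c d : cell lam) :
  (cell_row c) = (cell_row d) -> (cell_col c) = (cell_col d) -> c = d.
Proof.
move=> e1 e2; apply: val_inj; move: e1 e2; rewrite /cell_row /cell_col.
by case: (val c) (val d) => [a b] [a' b'] /= /val_inj -> /val_inj ->.
Qed.

Definition entry lam k (T : {ffun cell lam -> 'I_k}) (i j : nat) : nat :=
  if [pick c : cell lam | (cell_row c == i) && (cell_col c == j)] is Some c
  then T c else 0.

Lemma entryE lam k (T : {ffun cell lam -> 'I_k}) (c : cell lam) :
  entry T (cell_row c) (cell_col c) = T c.
Proof.
rewrite /entry; case: pickP => [d /andP[/eqP e1 /eqP e2]|/(_ c)].
  by congr (nat_of_ord (T _)); exact: cell_inj.
by rewrite !eqxx.
Qed.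

Lemma entry_lt lam k (T : {ffun cell lam -> 'I_k}) i j : weakly_decreasing lam ->
  j < nth 0 lam i -> entry T i j < k.
Proof.
by move=> dl /(cell_at dl)[c [<- <-]]; rewrite entryE.
Qed.

Definition standard_entries lam (t : nat -> nat -> nat) :=
  (forall i j j', j <= j' -> j' < nth 0 lam i -> t i j <= t i j') /\
  (forall i i' j, i < i' -> j < nth 0 lam i' -> t i j < t i' j).

Lemma semistandardP lam k (T : {ffun cell lam -> 'I_k}) : weakly_decreasing lam ->
  reflect (standard_entries lam (entry T)) (semistandard T).
Proof.
move=> dl; apply: (iffP forallP) => [h|[h1 h2] c].
  split=> [i j j' jj' j'l|i i' j ii' jl].
    have [c [c1 c2]] := cell_at dl (leq_ltn_trans jj' j'l).
    have [d [d1 d2]] := cell_at dl j'l.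
    move/forallP: (h c) => /(_ d) /andP[/implyP hh _].
    rewrite -{1}c1 -c2 -d1 -d2 !entryE; apply: hh.
    rewrite -val_eqE; apply/andP; split; first by apply/eqP; exact: etrans c1 (esym d1).
    by change (cell_col c <= cell_col d); rewrite c2 d2.
  have jl' : j < nth 0 lam i by rewrite (leq_trans jl)// weakly_decreasing_nth// ltnW.
  have [c [c1 c2]] := cell_at dl jl'; have [d [d1 d2]] := cell_at dl jl.
  move/forallP: (h c) => /(_ d) /andP[_ /implyP hh].
  rewrite -c1 -{1}c2 -d1 -d2 !entryE; apply: hh.
  rewrite -val_eqE; apply/andP; split; first by apply/eqP; exact: etrans c2 (esym d2).
  by change (cell_row c < cell_row d); rewrite c1 d1.
apply/forallP => d; apply/andP; split; apply/implyP => /andP[/eqP/(congr1 val) e hl].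
  have {}e : (cell_row c) = (cell_row d) by [].
  by have := h1 _ _ _ hl (cell_lt d); rewrite -{1}e !entryE.
have {}e : (cell_col c) = (cell_col d) by [].
have hd : (cell_col c) < nth 0 lam (cell_row d) by rewrite e cell_lt.
by have := h2 _ _ _ hl hd; rewrite {2}e !entryE.
Qed.

Lemma entry_ge_row lam t : weakly_decreasing lam -> standard_entries lam t ->
  forall i j, j < nth 0 lam i -> i <= t i j.
Proof.
move=> dl [_ h2]; elim=> // i IH j jl.
by rewrite (leq_ltn_trans (IH j (leq_trans jl (dl i))))// h2.
Qed.

Lemma initial_segment (p : nat -> bool) m :
  (forall j j', j <= j' -> j' < m -> p j' -> p j) ->
  exists2 r, r <= m & forall j, j < m -> p j = (j < r).
Proof.
elim: m => [|m IH] hp; first by exists 0.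
have [|r rm hr] := IH; first by move=> j j' jj' j'm; apply: hp => //; exact: ltnW.
case pm : (p m).
  exists m.+1 => // j jm; rewrite jm; apply: hp pm => //.
exists r; first exact: leqW.
move=> j; rewrite ltnS leq_eqVlt => /predU1P[->|]; last exact: hr.
by rewrite pm ltnNge rm.
Qed.

Lemma prod_cells (A : comNzRingType) lam (g : nat -> nat -> A) : weakly_decreasing lam ->
  (\prod_(c : cell lam) g (cell_row c) (cell_col c)
   = \prod_(i < size lam) \prod_(j < nth 0 lam i) g i j)%R.
Proof.
move=> dl; symmetry.
transitivity (\prod_(i < size lam) \prod_(j < head 0 lam | (j < nth 0%N lam i)%N) g i j)%R.
  apply: eq_bigr => i _; apply: (big_ord_widen _ (fun j => g i j)).
  by rewrite -nth0 weakly_decreasing_nth.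
rewrite pair_big_dep /=.
by rewrite -(big_sub (fun p : 'I_(size lam) * 'I_(head 0 lam) => p.2 < nth 0 lam p.1)
  (fun p => g p.1 p.2)).
Qed.

Variables (A : comNzRingType) (n : nat) (lam : seq nat).
Hypothesis dl : weakly_decreasing lam.
Hypothesis size_lam : size lam = n.+1.

Section FixedShape.
Variable f : {ffun 'I_n -> 'I_(head 0 lam).+1}.
Hypothesis hf : interlacing lam f.
Let mu := ffun_parts f.

Lemma size_ffun_parts : size mu = n.
Proof. by rewrite size_map size_enum_ord. Qed.

Lemma interlacing_nth i : i < n -> nth 0 lam i.+1 <= nth 0 mu i <= nth 0 lam i.
Proof.
by move=> hi; have /forallP/(_ (Ordinal hi)) := hf; rewrite -(nth_ffun_parts f).
Qed.

Lemma ffun_parts_default i : n <= i -> nth 0 mu i = 0.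
Proof. by move=> ni; rewrite nth_default// size_ffun_parts. Qed.

Lemma ffun_parts_le i : nth 0 mu i <= nth 0 lam i.
Proof.
case: (ltnP i n) => hi; last by rewrite ffun_parts_default.
by have /andP[] := interlacing_nth hi.
Qed.

Lemma ffun_parts_decreasing : weakly_decreasing mu.
Proof.
move=> i; case: (ltnP i n) => hi; last by rewrite ffun_parts_default// leqW.
by rewrite (leq_trans (ffun_parts_le _))//; have /andP[] := interlacing_nth hi.
Qed.

Definition has_subshape (T : {ffun cell lam -> 'I_n.+1}) :=
  [forall c : cell lam, (T c < n) == (cell_col c < nth 0 mu (cell_row c))].

Definition extend_tableau (T : {ffun cell mu -> 'I_n}) : {ffun cell lam -> 'I_n.+1} :=
  [ffun c : cell lam => inord (if (cell_col c) < nth 0 mu (cell_row c)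
                               then entry T (cell_row c) (cell_col c) else n) : 'I_n.+1].

(* The row number only serves as a default value, which the empty type ['I_0]
   cannot provide. *)
Definition restrict_tableau (T : {ffun cell lam -> 'I_n.+1}) : {ffun cell mu -> 'I_n} :=
  [ffun c : cell mu => insubd (cast_ord size_ffun_parts (val c).1)
                              (entry T (cell_row c) (cell_col c))].

Lemma entry_extend T i j : j < nth 0 lam i ->
  entry (extend_tableau T) i j = if j < nth 0 mu i then entry T i j else n.
Proof.
move=> /(cell_at dl)[c [<- <-]]; rewrite entryE ffunE inordK//.
by case: ifP => // h; rewrite leqW// entry_lt//; exact: ffun_parts_decreasing.
Qed.

Lemma restrict_extend T : restrict_tableau (extend_tableau T) = T.
Proof.
apply/ffunP=> c; apply: val_inj; rewrite ffunE val_insubd.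
have hc : (cell_col c) < nth 0 mu (cell_row c) := cell_lt c.
by rewrite (entry_extend _ (leq_trans hc (ffun_parts_le _))) hc entryE ltn_ord.
Qed.

Lemma extend_subshape T : has_subshape (extend_tableau T).
Proof.
apply/forallP => c; apply/eqP.
rewrite -entryE entry_extend; last exact: (cell_lt c).
case: ifP => h; last by rewrite ltnn.
by rewrite entry_lt//; exact: ffun_parts_decreasing.
Qed.

Lemma extend_restrict T : has_subshape T -> extend_tableau (restrict_tableau T) = T.
Proof.
move/forallP => hT; apply/ffunP=> c; apply: ord_inj; rewrite -!entryE.
rewrite entry_extend; last exact: (cell_lt c).
have /eqP := hT c; case: ifP => h hc; last first.
  by rewrite entryE; apply/eqP; rewrite eqn_leq leqNgt hc /= -ltnS ltn_ord.
have [d [d1 d2]] := cell_at ffun_parts_decreasing h.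
by rewrite -{1}d1 -{1}d2 entryE ffunE val_insubd d1 d2 entryE hc.
Qed.

Lemma semistandard_extend T : semistandard (extend_tableau T) = semistandard T.
Proof.
have dm := ffun_parts_decreasing.
apply/(semistandardP _ dl)/(semistandardP _ dm) => -[h1 h2]; split.
- move=> i j j' jj' hj'; have hj := leq_ltn_trans jj' hj'.
  have l := leq_trans hj (ffun_parts_le i); have l' := leq_trans hj' (ffun_parts_le i).
  by have := h1 i j j' jj' l'; rewrite !entry_extend// hj hj'.
- move=> i i' j ii' hj'; have hj := leq_trans hj' (weakly_decreasing_nth dm (ltnW ii')).
  have l := leq_trans hj (ffun_parts_le i); have l' := leq_trans hj' (ffun_parts_le i').
  by have := h2 i i' j ii' l'; rewrite !entry_extend// hj hj'.
- move=> i j j' jj' hj'; have hj := leq_ltn_trans jj' hj'.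
  rewrite !entry_extend//; case: (ltnP j' (nth 0 mu i)) => hm'.
    by rewrite (leq_ltn_trans jj' hm') h1.
  by case: ifP => // hm; rewrite ltnW// entry_lt.
- move=> i i' j ii' hj'; have hj := leq_trans hj' (weakly_decreasing_nth dl (ltnW ii')).
  have hi' : i' < n.+1.
    by rewrite -size_lam ltnNge; apply: contraL hj' => hi'; rewrite nth_default.
  have hm : j < nth 0 mu i.
    have /andP[h _] := interlacing_nth (leq_trans ii' hi').
    by rewrite (leq_trans _ h)// (leq_trans hj')// weakly_decreasing_nth.
  rewrite !entry_extend// hm; case: ifP => hm'; first exact: h2.
  by rewrite entry_lt.
Qed.

Lemma sum_subshape (x : 'I_n.+1 -> A) :
  (\sum_(T | semistandard T && has_subshape T) \prod_(c : cell lam) x (T c)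
  = x ord_max ^+ nth 0 lam n * ((\prod_(i < n) x ord_max ^+ (nth 0 lam i - f i)) *
    schur mu (fun i => x (widen_ord (leqnSn n) i))))%R.
Proof.
rewrite (reindex_onto extend_tableau restrict_tableau) => [|T /andP[_]]; last first.
  exact: extend_restrict.
rewrite /schur !mulr_sumr; apply: eq_big => [T|T sT].
  by rewrite semistandard_extend extend_subshape restrict_extend eqxx !andbT.
pose g i j := x (inord (if j < nth 0 mu i then entry T i j else n)).
rewrite (eq_bigr (fun c : cell lam => g (cell_row c) (cell_col c))) => [|c _]; last first.
  by rewrite ffunE.
rewrite prod_cells// size_lam big_ord_recr /= mulrC; congr (_ * _)%R.
  rewrite (eq_bigr (fun=> x ord_max)) ?prodr_const ?card_ord// => j _.
  rewrite /g ffun_parts_default//=; congr x; apply: val_inj => /=.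
  by rewrite inordK.
rewrite (eq_bigr (fun c : cell mu => x (inord (entry T (cell_row c) (cell_col c))))); last first.
  by move=> c _; congr x; apply: ord_inj; rewrite entryE inordK// ltnW// ltnS.
rewrite (prod_cells (fun i j => x (inord (entry T i j)))); last exact: ffun_parts_decreasing.
rewrite size_ffun_parts -big_split; apply: eq_bigr => i _ /=.
have hm := ffun_parts_le i.
rewrite -(big_mkord xpredT (g i)) (big_cat_nat (n := nth 0 mu i))//= mulrC.
congr (_ * _)%R; last first.
  by rewrite big_mkord; apply: eq_bigr => j _; rewrite /g ltn_ord.
rewrite -(nth_ffun_parts f i) -prodr_const_nat; apply: eq_big_nat => j /andP[hj _].
by rewrite /g ltnNge hj /=; congr x; apply: ord_inj; rewrite inordK.
Qed.

End FixedShape.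

Lemma subshape_exists T : semistandard T ->
  exists2 f : {ffun 'I_n -> 'I_(head 0 lam).+1},
    interlacing lam f & forall f', interlacing lam f' && has_subshape f' T = (f' == f).
Proof.
move/(semistandardP _ dl) => sT; have [h1 h2] := sT.
have row (i : 'I_n) : exists m : 'I_(head 0 lam).+1, nth 0 lam i.+1 <= m <= nth 0 lam i /\
    forall j, j < nth 0 lam i -> (entry T i j < n) = (j < m).
  have [|m mi hm] := @initial_segment (fun j => entry T i j < n) (nth 0 lam i).
    by move=> j j' jj' j'l /(leq_ltn_trans _); apply; exact: h1.
  have mh : m < (head 0 lam).+1 by rewrite ltnS -nth0 (leq_trans mi)// weakly_decreasing_nth.
  exists (Ordinal mh); split=> //=; rewrite mi andbT leqNgt; apply/negP => lt_m.
  have hml := leq_trans lt_m (dl i).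
  have := hm _ hml; rewrite ltnn => /negbT; rewrite -leqNgt => ge_n.
  have := leq_ltn_trans ge_n (h2 i i.+1 _ (ltnSn i) lt_m).
  by rewrite ltnNge -ltnS entry_lt.
have [f0 hf0] := fin_all_exists row.
pose f := [ffun i => f0 i].
have hf : interlacing lam f.
  by apply/forallP => i; rewrite ffunE; case: (hf0 i).
exists f => // f'; apply/andP/eqP => [[hf' /forallP sf']|->].
  apply/ffunP => i; apply: val_inj; rewrite ffunE /=; have [/andP[_ m1] m2] := hf0 i.
  have /forallP/(_ i)/andP[_ m1'] := hf'.
  have m2' j : j < nth 0 lam i -> (entry T i j < n) = (j < f' i).
    move=> /(cell_at dl)[c [c1 c2]]; have /eqP := sf' c.
    by rewrite -entryE c1 c2 nth_ffun_parts.
  case: (ltngtP (f' i) (f0 i)) => // hlt.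
    by move: (m2' _ (leq_trans hlt m1)); rewrite (m2 _ (leq_trans hlt m1)) hlt ltnn.
  by move: (m2 _ (leq_trans hlt m1')); rewrite (m2' _ (leq_trans hlt m1')) hlt ltnn.
split=> //; apply/forallP => c; apply/eqP; have hc := cell_lt c.
rewrite -entryE; case: (ltnP (cell_row c) n) => hi.
  have [_ h] := hf0 (Ordinal hi).
  by rewrite (nth_ffun_parts f (Ordinal hi)) ffunE -h.
rewrite ffun_parts_default// ltn0 ltnNge; apply/negbTE; rewrite negbK.
by rewrite (leq_trans hi)// (entry_ge_row dl sT).
Qed.

Lemma schur_branching (x : 'I_n.+1 -> A) :
  schur lam x = (x ord_max ^+ nth 0 lam n *
    \sum_(f : {ffun 'I_n -> 'I_(head 0 lam).+1} | interlacing lam f)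
      (\prod_(i < n) x ord_max ^+ (nth 0 lam i - f i)) *
      schur (ffun_parts f) (fun i => x (widen_ord (leqnSn n) i)))%R.
Proof.
rewrite mulr_sumr -(eq_bigr _ (fun f hf => sum_subshape hf x)).
rewrite (exchange_big_dep (fun T => semistandard T)) /=; last by move=> f T _ /andP[].
apply: eq_bigr => T sT; have [f hf fE] := subshape_exists sT.
by rewrite (big_pred1 f)// => f'; rewrite sT [RHS]/= -fE.
Qed.

End Tableaux.

Section HookRemoval.
Local Open Scope nat_scope.
Implicit Types lam : seq nat.

Lemma weakly_decreasing_cons a lam : weakly_decreasing (a :: lam) -> weakly_decreasing lam.
Proof. by move=> dl i; exact: (dl i.+1). Qed.

Lemma lt_conj_part lam i j : weakly_decreasing lam ->
  (i < conj_part lam j) = (j < nth 0 lam i).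
Proof.
elim: lam i => [|a lam IH] i dl; first by rewrite nth_nil.
rewrite /conj_part /= -/(conj_part lam j); have dl' := weakly_decreasing_cons dl.
case: (ltnP j a) => ja; case: i => [|i] //=.
- by rewrite add1n ltnS IH.
- have := IH 0 dl'; rewrite add0n => ->; rewrite ltnNge (ltnNge j a) ja.
  by rewrite (leq_trans (dl 0)).
- rewrite add0n IH// !ltnNge (leq_trans (weakly_decreasing_nth dl (leq0n i.+2))) //.
  by rewrite (leq_trans (weakly_decreasing_nth dl (leq0n i.+1))).
Qed.

Lemma lt_frob_rank lam i : weakly_decreasing lam ->
  (i < frob_rank lam) = (i < nth 0 lam i).
Proof.
move=> dl; apply/idP/idP => [|hi].
  apply: contraLR; rewrite -!leqNgt => hi; apply/bigmax_leqP => m hm.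
  by rewrite ltnNge; apply: contraL hm => im; rewrite -leqNgt
    (leq_trans (weakly_decreasing_nth dl im))// (leq_trans hi).
have hs : i < size lam by rewrite ltnNge; apply: contraL hi => hi; rewrite nth_default.
exact: (@leq_bigmax_cond _ _ (fun j : 'I_(size lam) => j.+1) (Ordinal hs)).
Qed.

(* First row and first column deleted; the final 0 keeps the length. *)
Definition unhook lam := rcons (map predn (behead lam)) 0.

Lemma size_unhook lam : 0 < size lam -> size (unhook lam) = size lam.
Proof. by case: lam => // a lam _; rewrite size_rcons size_map. Qed.

Lemma nth_unhook lam i : nth 0 (unhook lam) i = (nth 0 lam i.+1).-1.
Proof.
rewrite /unhook nth_rcons size_map -nth_behead; case: ltnP => hi.
  by rewrite (nth_map 0).
by rewrite if_same (nth_default _ hi).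
Qed.

Lemma unhook_decreasing lam : weakly_decreasing lam -> weakly_decreasing (unhook lam).
Proof. by move=> dl i; rewrite !nth_unhook -!subn1 leq_sub2r. Qed.

Lemma conj_part_unhook lam j : weakly_decreasing lam -> 0 < nth 0 lam 0 ->
  conj_part (unhook lam) j = (conj_part lam j.+1).-1.
Proof.
move=> dl l0; have du := unhook_decreasing dl.
have h i : (i < conj_part (unhook lam) j) = (i.+1 < conj_part lam j.+1).
  by rewrite !lt_conj_part// nth_unhook ltn_predRL.
case: (ltngtP (conj_part (unhook lam) j) (conj_part lam j.+1).-1) => // hlt.
  by have := h (conj_part (unhook lam) j); rewrite ltnn -ltn_predRL hlt.
by have := h (conj_part lam j.+1).-1; rewrite hlt -ltn_predRL ltnn.
Qed.

Lemma frob_rank_unhook lam : weakly_decreasing lam -> 0 < nth 0 lam 0 ->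
  frob_rank lam = (frob_rank (unhook lam)).+1.
Proof.
move=> dl l0; have du := unhook_decreasing dl.
have h i : (i < frob_rank lam) = (i < (frob_rank (unhook lam)).+1).
  case: i => [|i]; first by rewrite lt_frob_rank.
  by rewrite ltnS !lt_frob_rank// nth_unhook ltn_predRL.
apply/eqP; rewrite eqn_leq; apply/andP; split; rewrite leqNgt; apply/negP => hlt.
  by have := h (frob_rank (unhook lam)).+1; rewrite hlt ltnn.
by have := h (frob_rank lam); rewrite hlt ltnn.
Qed.

Lemma sumn_predn lam : sumn (map predn lam) + conj_part lam 0 = sumn lam.
Proof.
elim: lam => //= a lam IH; rewrite /conj_part /= -/(conj_part lam 0) -IH.
by case: a => [|a] /=; lia.
Qed.

Lemma sumn_unhook lam : 0 < nth 0 lam 0 ->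
  sumn lam = sumn (unhook lam) + nth 0 lam 0 + (conj_part lam 0).-1.
Proof.
case: lam => // a lam /= a0; rewrite /unhook /= sumn_rcons addn0 -(sumn_predn lam).
by rewrite /conj_part /= a0 add1n /=; lia.
Qed.

Definition content_balance lam (d : int) := forall i, i < nth 0 lam i ->
  ((nth 0 lam i)%:Z - (conj_part lam i)%:Z = d)%R.

Lemma balance_unhook lam d : weakly_decreasing lam -> 0 < nth 0 lam 0 ->
  content_balance lam d -> content_balance (unhook lam) d.
Proof.
move=> dl l0 hd i; rewrite nth_unhook ltn_predRL => hi.
rewrite conj_part_unhook// -(hd _ hi).
have := lt_conj_part i.+1 i.+1 dl; rewrite hi => hc.
by case: (nth 0 lam i.+1) hi => [//|a] _; case: (conj_part _ _) hc => [//|b] _ /=; lia.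
Qed.

Lemma frobenius_balance lam al be : weakly_decreasing lam -> frobenius lam = (al, be) ->
  forall i, i < nth 0 lam i ->
  [/\ i < size al, i < size be, nth 0 lam i = nth 0 al i + i.+1
    & conj_part lam i = nth 0 be i + i.+1].
Proof.
move=> dl [<- <-] i hi; have hr : i < frob_rank lam by rewrite lt_frob_rank.
by rewrite !size_mkseq !nth_mkseq// !subnK// lt_conj_part.
Qed.

Lemma typeC_balance lam : weakly_decreasing lam -> typeC lam -> content_balance lam 1.
Proof.
move=> dl [al _ /(frobenius_balance dl) h] i hi.
by have [_ hs -> ->] := h i hi; rewrite (nth_map 0)//; lia.
Qed.

Lemma typeD_balance lam : weakly_decreasing lam -> typeD lam -> content_balance lam (-1).
Proof.
move=> dl [al _ /(frobenius_balance dl) h] i hi.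
by have [hs _ -> ->] := h i hi; rewrite (nth_map 0)//; lia.
Qed.

Lemma typeB_balance lam : weakly_decreasing lam -> typeB lam -> content_balance lam 0.
Proof.
move=> dl [al _ /(frobenius_balance dl) h] i hi.
by have [_ _ -> ->] := h i hi; lia.
Qed.

Section ColumnReduction.
Local Open Scope ring_scope.
Variables (F : comNzRingType) (eps : F) (d : int).

Lemma det_unhook k (phi : 'I_k -> int -> F) lam :
  (forall i b, phi i (d + 1 - b) = eps * phi i b) ->
  weakly_decreasing lam -> size lam = k -> (0 < nth 0%N lam 0)%N ->
  content_balance lam d ->
  \det (\matrix_(i, j < k) phi i (npos lam j)) =
  eps * (-1) ^+ (conj_part lam 0).-1 * \det (\matrix_(i, j < k) phi i (npos (unhook lam) j)).
Proof.
move=> phi_sym dl sl l0 hd; case: k phi phi_sym sl => [|n] phi phi_sym sl.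
  by move/size0nil: sl l0 => ->.
pose p := (conj_part lam 0).-1.
have c0 : (0 < conj_part lam 0)%N by rewrite lt_conj_part.
have lp j : (j < p)%N = (0 < nth 0%N lam j.+1)%N by rewrite -lt_conj_part// -ltn_predRL.
have pn : (p < n.+1)%N.
  by rewrite -ltnS prednK// ltnS -sl count_size.
pose op := Ordinal pn; pose s := lift_perm ord0 op (1%g : 'S_n).
pose M := \matrix_(i, j < n.+1) phi i (npos (unhook lam) j).
pose D : 'rV[F]_n.+1 := \row_j if j == ord0 then eps else 1.
have -> : \matrix_(i, j < n.+1) phi i (npos lam j) = col_perm s M *m diag_mx D.
  apply/matrixP => i j; rewrite mul_mx_diag !mxE /npos nth_unhook.
  case: (unliftP ord0 j) => [m|] ->; last first.
    rewrite lift_perm_id eqxx /= mulrC subr0.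
    have /negbT := ltnn p; rewrite lp -eqn0Ngt => /eqP ->; rewrite sub0r -phi_sym.
    congr phi; move: (hd 0%N l0) c0; rewrite /p; case: (conj_part lam 0) => // q <- _ /=.
    by rewrite -addn1 PoszD; ring.
  rewrite lift_perm_lift perm1 eq_sym (negbTE (neq_lift _ _)) mulr1 lift0 /= /bump /=.
  congr phi; case: (leqP p m) => hm.
    have z i' : (p <= i')%N -> nth 0%N lam i'.+1 = 0%N.
      by rewrite leqNgt lp -eqn0Ngt => /eqP.
    by rewrite add1n !z// leqW.
  have := lp m; rewrite hm add0n => /esym.
  by case: (nth 0%N lam m.+1) => // a _; rewrite /= -(addn1 a) -(addn1 m) !PoszD; ring.
rewrite det_mulmx det_diag big_ord_recl mxE eqxx big1 ?mulr1 => [|j _]; last by rewrite mxE.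
rewrite col_permE det_mulmx det_perm odd_permV odd_lift_perm odd_perm1 addbF /=.
by rewrite signr_odd -/M -/p; ring.
Qed.

Lemma det_column_reduction k (phi : 'I_k -> int -> F) (sgn : seq nat -> F) lam :
  (forall i b, phi i (d + 1 - b) = eps * phi i b) ->
  (forall mu, nth 0%N mu 0 = 0%N -> weakly_decreasing mu -> sgn mu = 1) ->
  (forall mu, weakly_decreasing mu -> (0 < nth 0%N mu 0)%N -> content_balance mu d ->
     sgn mu = eps * (-1) ^+ (conj_part mu 0).-1 * sgn (unhook mu)) ->
  weakly_decreasing lam -> size lam = k -> content_balance lam d ->
  \det (\matrix_(i, j < k) phi i (npos lam j)) =
  sgn lam * \det (\matrix_(i, j < k) phi i (- (j%:Z))).
Proof.
move=> phi_sym sgn0 sgnS; have [m] := ubnP (sumn lam).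
elim: m lam => // m IH lam lm dl sl hd; have [l0|l0] := posnP (nth 0%N lam 0).
  rewrite sgn0// mul1r; congr (\det _); apply/matrixP => i j; rewrite !mxE /npos.
  have := weakly_decreasing_nth dl (leq0n j); rewrite l0 leqn0 => /eqP ->.
  by rewrite sub0r.
rewrite (det_unhook phi_sym dl sl l0 hd) sgnS// -mulrA IH ?mulrA//.
- by move: lm; rewrite sumn_unhook//; lia.
- exact: unhook_decreasing.
- by rewrite size_unhook//; case: (lam) l0.
- exact: balance_unhook.
Qed.

End ColumnReduction.

End HookRemoval.

Section Specialization.
Variable F : fieldType.

Lemma schur_nil (A : comNzRingType) (x : 'I_0 -> A) : schur [::] x = 1.
Proof.
have cell0 (c : cell [::]) : False by have := cell_lt c; rewrite nth_nil.
rewrite /schur (big_pred1 [ffun c : cell [::] => (val c).1]) => [|T /=].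
  by rewrite big1// => c _; case: (cell0 c).
have -> : semistandard T by apply/forallP => c; case: (cell0 c).
by apply/esym/eqP/ffunP => c; case: (cell0 c).
Qed.

(* Reversed, so that removing the head of the list removes the largest letter
   of the tableaux. *)
Definition rev_values (T : Type) n (x : 'I_n -> T) : seq T := rev [seq x i | i <- enum 'I_n].

Lemma size_rev_values (T : Type) n (x : 'I_n -> T) : size (rev_values x) = n.
Proof. by rewrite size_rev size_map size_enum_ord. Qed.

Lemma rev_valuesS (T : Type) n (x : 'I_n.+1 -> T) :
  rev_values x = x ord_max :: rev_values (fun i => x (widen_ord (leqnSn n) i)).
Proof. by rewrite /rev_values enum_ordSr map_rcons rev_rcons -map_comp. Qed.

Lemma big_rev_values (A : Type) (idx : A) (op : Monoid.com_law idx) n (x : 'I_n -> F)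
    (g : F -> A) : \big[op/idx]_(y <- rev_values x) g y = \big[op/idx]_(i < n) g (x i).
Proof. by rewrite big_rev big_map big_enum. Qed.

Lemma det_power_mx n (x : 'I_n -> F) lam : weakly_decreasing lam -> size lam = n ->
  \det (power_mx n (rev_values x) lam) = (\prod_(j < n) (-1) ^+ j) * schur lam x.
Proof.
elim: n x lam => [|n IH] x lam dl sl.
  by move/size0nil: sl => ->; rewrite schur_nil det_mx00 big_ord0 mul1r.
rewrite rev_valuesS power_mx_branching// schur_branching//.
rewrite big_ord_recr /= -mulrA [RHS]mulrCA; congr (_ * _).
rewrite [RHS]mulrCA; congr (_ * _).
rewrite mulr_sumr; apply: eq_bigr => f hf.
have dm := ffun_parts_decreasing (lam := lam) hf.
by rewrite IH ?size_ffun_parts// mulrCA.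
Qed.

Lemma schur_scale (A : comNzRingType) n lam c (x : 'I_n -> A) : weakly_decreasing lam ->
  schur lam (fun i => c * x i) = c ^+ sumn lam * schur lam x.
Proof.
move=> dl; rewrite /schur mulr_sumr; apply: eq_bigr => T _.
rewrite big_split /=; congr (_ * _).
rewrite (prod_cells (fun _ _ => c) dl).
under eq_bigr do rewrite prodr_const card_ord.
by rewrite prodrXr sumnE (big_nth 0%N) big_mkord.
Qed.

Lemma pair_prod_rev_values n (x : 'I_n -> F) : pair_prod (rev_values x) =
  \prod_(i < n) \prod_(j < n | (i < j)%N) (1 - x i * x j).
Proof.
elim: n x => [|n IH] x; first by rewrite big_ord0 /rev_values enum_ord0.
rewrite rev_valuesS /= IH big_rev_values big_ord_recr /=.
rewrite [X in _ = _ * X]big_pred0 ?mulr1; last first.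
  by move=> j; rewrite ltnNge -ltnS ltn_ord.
rewrite -big_split; apply: eq_bigr => i _ /=.
by rewrite [RHS]big_mkcond big_ord_recr /= ltn_ord -big_mkcond mulrC [x ord_max * _]mulrC.
Qed.

Lemma prod_reciprocal (ys : seq F) :
  \prod_(y <- ys) \prod_(v <- ys) (1 - v * y)
  = pair_prod ys ^+ 2 * \prod_(y <- ys) (1 - y ^+ 2).
Proof.
elim: ys => [|y ys IH]; first by rewrite !big_nil expr1n mulr1.
rewrite big_cons; under [X in _ * X = _]eq_bigr do rewrite big_cons.
rewrite big_split /= IH !big_cons.
under eq_bigr do rewrite mulrC.
ring.
Qed.

(* The coefficient of [z^b] in [(z + 1/z)^l]. *)
Fixpoint laurent_coef (l : nat) (b : int) : F :=
  if l is l'.+1 then laurent_coef l' (b - 1) + laurent_coef l' (b + 1) else (b == 0)%:R.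

Lemma laurent_coefN l b : laurent_coef l (- b) = laurent_coef l b.
Proof.
elim: l b => [|l IH] b /=; first by rewrite oppr_eq0.
by rewrite -opprD IH addrC -[- b + 1]opprK IH opprD opprK.
Qed.

Lemma laurent_coef_gt l (b : int) : l%:Z < b -> laurent_coef l b = 0.
Proof.
elim: l b => [|l IH] b hb /=; first by rewrite gt_eqF.
by rewrite !IH ?addr0//; move: hb; rewrite -[l.+1]addn1 PoszD; lia.
Qed.

Lemma laurent_coef_diag l : laurent_coef l l = 1.
Proof.
elim: l => [|l IH] //=.
rewrite -addn1 PoszD addrK IH laurent_coef_gt ?addr0//; lia.
Qed.

Definition recip_poly (ys : seq F) : {poly F} := \prod_(y <- ys) (1 - y *: 'X).

Lemma horner_recip_poly ys z : (recip_poly ys).[z] = \prod_(y <- ys) (1 - y * z).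
Proof. by rewrite horner_prod; apply: eq_bigr => y _; rewrite !hornerE. Qed.

Definition kernel_mx n ys : 'M[F]_n :=
  invmx (mul_mx n ys (recip_poly ys)) *m cpoly_mx n ys.

Lemma det_kernel_factorization n (x : 'I_n -> F) lam (N : {poly F}) (Phi : 'M[F]_n) :
  weakly_decreasing lam -> size lam = n ->
  (forall i j, 1 - x i * x j != 0) -> (forall i, 1 + x i ^+ 2 != 0) ->
  \det (power_mx n (rev_values x) lam *m mul_mx n (rev_values x) N
        *m kernel_mx n (rev_values x) *m Phi) =
  schur lam x * (\prod_(i < n) N.[x i])
  / ((\prod_(i < n) (1 - x i ^+ 2)) * \prod_(i < n) \prod_(j < n | (i < j)%N) (1 - x i * x j))
  * \det Phi.
Proof.
move=> dl sl hx hx2; set ys := rev_values x; have sy : size ys = n by rewrite size_rev_values.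
rewrite !det_mulmx det_inv !det_mul_mx// det_power_mx// det_cpoly_mx//; last first.
  rewrite all_rev all_map; apply/allP => i _ /=; rewrite hx2 /=.
  by rewrite expr2 hx.
have -> : \prod_(y <- ys) (recip_poly ys).[y] = \prod_(y <- ys) \prod_(v <- ys) (1 - v * y).
  by apply: eq_bigr => y _; rewrite horner_recip_poly.
rewrite prod_reciprocal !big_rev_values -pair_prod_rev_values -/ys.
have p0 : pair_prod ys != 0.
  rewrite pair_prod_rev_values; apply/prodf_neq0 => i _; apply/prodf_neq0 => j _.
  exact: hx.
have q0 : \prod_(i < n) (1 - x i ^+ 2) != 0.
  by apply/prodf_neq0 => i _; rewrite expr2 hx.
have s2 : (\prod_(j < n) (-1) ^+ j) ^+ 2 = 1 :> F.
  by rewrite -prodrXl big1// => j _; rewrite sqrr_sign.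
set s := \prod_(j < n) (-1) ^+ j in s2 *.
transitivity (s ^+ 2 * (schur lam x * \prod_(i < n) N.[x i]
  / (\prod_(i < n) (1 - x i ^+ 2) * pair_prod ys) * \det Phi)).
  by field; rewrite p0.
by rewrite s2 mul1r.
Qed.

End Specialization.

(** * Contour integrals *)

Section ContourMean.
Variable R : realType.
Local Notation C := R[i].
Implicit Types (f g : R -> C) (r t : R) (c : C).

Definition ccont f :=
  continuous (fun t => complex.Re (f t)) /\ continuous (fun t => complex.Im (f t)).

Lemma ccont_cst c : ccont (fun=> c).
Proof. by split=> t; apply: cvg_cst. Qed.

Lemma ccontD f g : ccont f -> ccont g -> ccont (fun t => f t + g t).
Proof.
move=> [fr fi] [gr gi].
have ->: (fun t => f t + g t) = fun t =>
    (complex.Re (f t) + complex.Re (g t)) +i* (complex.Im (f t) + complex.Im (g t)).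
  by apply/funext=> t; case: (f t) (g t) => [a b] [a' b'].
by split=> t /=; apply: cvgD; [exact: fr|exact: gr|exact: fi|exact: gi].
Qed.

Lemma ccontM f g : ccont f -> ccont g -> ccont (fun t => f t * g t).
Proof.
move=> [fr fi] [gr gi].
have ->: (fun t => f t * g t) = fun t =>
    (complex.Re (f t) * complex.Re (g t) - complex.Im (f t) * complex.Im (g t))
    +i* (complex.Re (f t) * complex.Im (g t) + complex.Im (f t) * complex.Re (g t)).
  by apply/funext=> t; case: (f t) (g t) => [a b] [a' b'].
by split=> t /=; [apply: cvgB|apply: cvgD]; apply: cvgM;
  by [exact: fr|exact: gr|exact: fi|exact: gi].
Qed.

Lemma ccontV f : (forall t, f t != 0) -> ccont f -> ccont (fun t => (f t)^-1).
Proof.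
move=> f0 [fr fi].
pose n2 t := complex.Re (f t) ^+ 2 + complex.Im (f t) ^+ 2.
have n20 t : n2 t != 0.
  apply: contraNneq (f0 t) => /eqP; rewrite paddr_eq0 ?sqr_ge0// !sqrf_eq0.
  by rewrite eq_complex.
have n2c t : n2 @ t --> n2 t.
  by apply: cvgD; rewrite expr2; apply: cvgM; by [exact: fr|exact: fi].
have ->: (fun t => (f t)^-1) = fun t =>
    (complex.Re (f t) * (n2 t)^-1) +i* (- (complex.Im (f t) * (n2 t)^-1)).
  by apply/funext=> t; rewrite /n2; case: (f t) => [a b].
split=> t /=; [|apply: cvgN]; apply: cvgM;
  by [exact: fr|exact: fi|apply: cvgV => //; exact: n2c].
Qed.

Lemma ccontX f n : ccont f -> ccont (fun t => f t ^+ n).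
Proof.
move=> fc; elim: n => [|n IH]; first exact: ccont_cst.
have ->: (fun t => f t ^+ n.+1) = fun t => f t * f t ^+ n.
  by apply/funext=> t; rewrite exprS.
exact: ccontM.
Qed.

Lemma ccont_prod (T : Type) (s : seq T) (F : T -> R -> C) :
  (forall i, ccont (F i)) -> ccont (fun t => \prod_(i <- s) F i t).
Proof.
move=> Fc; elim: s => [|i s IH].
  by under eq_fun do rewrite big_nil; exact: ccont_cst.
by under eq_fun do rewrite big_cons; exact: ccontM.
Qed.

Lemma ccont_sum (I : Type) (s : seq I) (F : I -> R -> C) :
  (forall i, ccont (F i)) -> ccont (fun t => \sum_(i <- s) F i t).
Proof.
move=> Fc; elim: s => [|i s IH].
  by under eq_fun do rewrite big_nil; exact: ccont_cst.
by under eq_fun do rewrite big_cons; exact: ccontD.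
Qed.

Lemma ccont_horner (p : {poly C}) f : ccont f -> ccont (fun t => p.[f t]).
Proof.
move=> fc; under eq_fun do rewrite horner_coef.
by apply: ccont_sum => i; apply: ccontM; [exact: ccont_cst|exact: ccontX].
Qed.

Definition cmean f : C :=
  complex_integral `[0, 2 * pi]%classic f / (2 * pi)%:C.

Local Notation mu := (@lebesgue_measure R).
Local Notation I2 := (`[0, 2 * pi]%classic : set R).

Lemma twopi_gt0 : 0 < 2 * pi :> R.
Proof. by rewrite mulr_gt0 ?pi_gt0. Qed.

Lemma twopiC_neq0 : (2 * pi)%:C != 0 :> C.
Proof. by rewrite (inj_eq (@complexI R)) ?gt_eqF ?twopi_gt0. Qed.

Lemma cont_integrable (h : R -> R) : continuous h -> mu.-integrable I2 (EFin \o h).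
Proof.
move=> hc; apply: continuous_compact_integrable; first exact: segment_compact.
exact: continuous_subspaceT.
Qed.

Lemma complex_integralD f g : ccont f -> ccont g ->
  complex_integral I2 (fun t => f t + g t) =
  complex_integral I2 f + complex_integral I2 g.
Proof.
move=> [fr fi] [gr gi]; rewrite /complex_integral.
have e1 t : complex.Re (f t + g t) = complex.Re (f t) + complex.Re (g t).
  by case: (f t) (g t) => [? ?] [? ?].
have e2 t : complex.Im (f t + g t) = complex.Im (f t) + complex.Im (g t).
  by case: (f t) (g t) => [? ?] [? ?].
under eq_Rintegral do rewrite e1.
rewrite RintegralD//; [|exact: cont_integrable..].
under [X in _ +i* X]eq_Rintegral do rewrite e2.
by rewrite RintegralD//; exact: cont_integrable.
Qed.

Lemma complex_integralZ c f : ccont f ->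
  complex_integral I2 (fun t => c * f t) = c * complex_integral I2 f.
Proof.
move=> [fr fi]; rewrite /complex_integral; case: c => a b.
have e1 t : complex.Re ((a +i* b) * f t) = a * complex.Re (f t) - b * complex.Im (f t).
  by case: (f t).
have e2 t : complex.Im ((a +i* b) * f t) = a * complex.Im (f t) + b * complex.Re (f t).
  by case: (f t) => u v.
have iZ (h : R -> R) (d : R) : continuous h -> mu.-integrable I2 (EFin \o (fun t => d * h t)).
  by move=> hc; apply: cont_integrable => t; apply: cvgM; [exact: cvg_cst|exact: hc].
under eq_Rintegral do rewrite e1.
rewrite RintegralB//; [|exact: iZ..].
under [X in _ +i* X]eq_Rintegral do rewrite e2.
rewrite RintegralD//; [|exact: iZ..].
rewrite !RintegralZl//; do ?exact: cont_integrable.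
Qed.

Lemma cmeanD f g : ccont f -> ccont g ->
  cmean (fun t => f t + g t) = cmean f + cmean g.
Proof. by move=> fc gc; rewrite /cmean complex_integralD// mulrDl. Qed.

Lemma cmeanZ c f : ccont f -> cmean (fun t => c * f t) = c * cmean f.
Proof. by move=> fc; rewrite /cmean complex_integralZ// mulrA. Qed.

Lemma cmean_cst c : cmean (fun=> c) = c.
Proof.
have I0 (a : R) : \int[mu]_(t in I2) a = a * (2 * pi).
  rewrite Rintegral_cst//= lebesgue_measure_itv/= lte_fin twopi_gt0/=.
  by rewrite subr0.
rewrite /cmean /complex_integral !I0.
apply: (mulIf twopiC_neq0); rewrite mulfVK ?twopiC_neq0//.
by case: c => a b; apply/eqP; rewrite eq_complex/= !mulr0 ?subr0 ?add0r !eqxx.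
Qed.

Lemma cmean_sum (I : Type) (s : seq I) (F : I -> R -> C) :
  (forall i, ccont (F i)) ->
  cmean (fun t => \sum_(i <- s) F i t) = \sum_(i <- s) cmean (F i).
Proof.
move=> Fc; elim: s => [|i s IH].
  by under eq_fun do rewrite big_nil; rewrite cmean_cst big_nil.
under eq_fun do rewrite big_cons.
by rewrite cmeanD ?IH ?big_cons//; exact: ccont_sum.
Qed.

Lemma cmean_bound f (M : R) : ccont f -> (forall t, `|f t| <= M%:C) ->
  `|cmean f| <= (2 * M)%:C.
Proof.
move=> [fr fi] fM.
have bd (h : R -> R) : continuous h -> (forall t, `|h t| <= M) ->
    `|\int[mu]_(t in I2) h t| <= M * (2 * pi).
  move=> hc hM; apply: (le_trans (le_normr_Rintegral _ _)) => //.
    exact: cont_integrable.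
  have <- : \int[mu]_(t in I2) M = M * (2 * pi).
    rewrite Rintegral_cst//= lebesgue_measure_itv/= lte_fin twopi_gt0/=.
    by rewrite subr0.
  apply: le_Rintegral => //; last first.
    by apply: cont_integrable => t; exact: cvg_cst.
  by apply: cont_integrable => t; apply: cvg_norm; exact: hc.
have normi : `|'i%C : C| = 1 by rewrite complexiE normCi.
have Re_le (z : C) : `|complex.Re z|%:C <= `|z| by exact: normc_ge_Re.
have Im_le (z : C) : `|complex.Im z|%:C <= `|z|.
  by have := normc_ge_Re (z * 'i%C); rewrite normrM normi mulr1 ReiNIm normrN.
rewrite /cmean normrM normfV ler_pdivrMr ?normr_gt0 ?twopiC_neq0//.
rewrite (ger0_norm (x := (2 * pi)%:C)); last by rewrite ler0c ltW ?twopi_gt0.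
rewrite -rmorphM /=.
have -> : 2 * M * (2 * pi) = M * (2 * pi) + M * (2 * pi) by ring.
rewrite [complex_integral _ _]complexE /=.
apply: (le_trans (ler_normD _ _)).
rewrite normrM normi mul1r.
have nr (a : R) : `|a%:C| = `|a|%:C :> C.
  by rewrite normc_def /= expr0n addr0 sqrtr_sqr.
rewrite !nr -rmorphD lecR lerD//.
  by rewrite bd// => t; rewrite -lecR (le_trans (Re_le _)).
by rewrite bd// => t; rewrite -lecR (le_trans (Im_le _)).
Qed.

End ContourMean.

Section Circle.
Variable R : realType.
Local Notation C := R[i].
Implicit Types (f g : R -> C) (r t : R) (c : C).

Lemma circle_ptM (a b s t : R) :
  circle_pt a s * circle_pt b t = circle_pt (a * b) (s + t).
Proof.
by apply/eqP; rewrite eq_complex /= cosD sinD; apply/andP; split; apply/eqP; ring.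
Qed.

Lemma circle_pt0 a : circle_pt a 0 = a%:C :> C.
Proof. by rewrite /circle_pt cos0 sin0 mulr1 mulr0. Qed.

Lemma norm_circle_pt r t : 0 <= r -> `|circle_pt r t| = r%:C.
Proof.
move=> r0; rewrite normc_def /= !exprMn -mulrDr cos2Dsin2 mulr1 sqrtr_sqr.
by rewrite ger0_norm.
Qed.

Lemma circle_pt_neq0 r t : 0 < r -> circle_pt r t != 0.
Proof.
by move=> r0; rewrite -normr_gt0 norm_circle_pt ?ltW// ltcR.
Qed.

Lemma circle_ptV r t : 0 < r -> (circle_pt r t)^-1 = circle_pt r^-1 (- t).
Proof.
move=> r0; apply: (mulfI (circle_pt_neq0 t r0)).
by rewrite mulfV ?circle_pt_neq0// circle_ptM divff ?gt_eqF// subrr circle_pt0.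
Qed.

Lemma circle_ptX r t n : circle_pt r t ^+ n = circle_pt (r ^+ n) (n%:R * t).
Proof.
elim: n => [|n IH]; first by rewrite !expr0 mul0r circle_pt0.
by rewrite !exprS IH circle_ptM -natr1 mulrDl mul1r addrC.
Qed.

Lemma circle_ptXz r t (n : int) : 0 < r ->
  circle_pt r t ^ n = circle_pt (r ^ n) (n%:~R * t).
Proof.
move=> r0; case: n => n; first by rewrite -!exprnP circle_ptX.
rewrite !NegzE -!exprnN circle_ptX circle_ptV ?exprn_gt0//.
by rewrite -mulNr mulrNz.
Qed.

Lemma ccont_circle_pt r (m : R) : ccont (fun t => circle_pt r (m * t)).
Proof.
have mc t : m * x @[x --> t] --> m * t by apply: cvgM; [exact: cvg_cst|exact: cvg_id].
split=> t /=; (apply: cvgM; first exact: cvg_cst).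
  by apply: continuous_comp; [exact: mc|exact: continuous_cos].
by apply: continuous_comp; [exact: mc|exact: continuous_sin].
Qed.

Lemma ccont_circle r : ccont (circle_pt r : R -> C).
Proof.
have -> : circle_pt r = fun t => circle_pt r (1 * t) by apply/funext=> t; rewrite mul1r.
exact: ccont_circle_pt.
Qed.

Lemma integral_deriv (h H : R -> R) : continuous h ->
  (forall t : R, is_derive t (1 : R) H (h t)) -> H (2 * pi) = H 0 ->
  \int[lebesgue_measure]_(t in `[0, 2 * pi]%classic) h t = 0.
Proof.
move=> hc dH H0; rewrite /Rintegral (@continuous_FTC2 _ h H).
- by rewrite -EFinB /= H0 subrr.
- exact: twopi_gt0.
- exact: continuous_subspaceT.
- have Hc t : H x @[x --> t] --> H t.
    apply: differentiable_continuous; apply/derivable1_diffP.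
    by have [] := dH t.
  split => [t _||]; first by have [] := dH t.
    exact: cvg_at_right_filter.
  exact: cvg_at_left_filter.
- by move=> t _; rewrite derive1E; have [_ ->] := dH t.
Qed.

Lemma cmean_circle (rho : R) (n : int) : n != 0 ->
  cmean (fun t => circle_pt rho (n%:~R * t)) = 0.
Proof.
move=> n0; pose m : R := n%:~R; have m0 : m != 0 by rewrite intr_eq0.
have sc : sin (m * (2 * pi)) = 0 /\ cos (m * (2 * pi)) = 1.
  have nat_case (k : nat) : sin (k%:R * (2 * pi) : R) = 0 /\ cos (k%:R * (2 * pi) : R) = 1.
    elim: k => [|k [IHs IHc]]; first by rewrite mul0r sin0 cos0.
    rewrite -natr1 mulrDl mul1r sinD cosD IHs IHc mulr2n mulrDl !mul1r.
    by rewrite sinD cosD sinpi cospi; split; ring.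
  rewrite /m; case: (n) => k; first exact: nat_case.
  rewrite NegzE mulrNz mulNr sinN cosN.
  by have [-> ->] := nat_case k.+1; rewrite oppr0.
case: sc => s0 c1.
have mc t : m * x @[x --> t] --> m * t by apply: cvgM; [exact: cvg_cst|exact: cvg_id].
have Ic : \int[lebesgue_measure]_(t in `[0, 2 * pi]%classic) (rho * cos (m * t)) = 0.
  apply: (@integral_deriv _ (fun t => rho * (m^-1 * sin (m * t)))) => [t|t|].
  + apply: cvgM; first exact: cvg_cst.
    by apply: continuous_comp; [exact: mc|exact: continuous_cos].
  + by apply: is_derive_eq; rewrite /GRing.scale/=; field.
  + by rewrite s0 !mulr0 sin0 !mulr0.
have Is : \int[lebesgue_measure]_(t in `[0, 2 * pi]%classic) (rho * sin (m * t)) = 0.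
  apply: (@integral_deriv _ (fun t => rho * (m^-1 * - cos (m * t)))) => [t|t|].
  + apply: cvgM; first exact: cvg_cst.
    by apply: continuous_comp; [exact: mc|exact: continuous_sin].
  + by apply: is_derive_eq; rewrite /GRing.scale/=; field.
  + by rewrite c1 !mulr0 cos0.
by rewrite /cmean /complex_integral /= Ic Is mul0r.
Qed.

End Circle.

Section GeometricMean.
Variable R : realType.
Local Notation C := R[i].

Lemma le0_geometric (a K q : R) : 0 <= q < 1 ->
  (forall j, a <= K * q ^+ j) -> a <= 0.
Proof.
move=> /andP[q0 q1] aK; rewrite leNgt; apply/negP => a0.
have /cvgr0_norm_lt /(_ _ a0) [N _ /(_ N (leqnn N))] : geometric K q @ \oo --> 0.
  by apply: cvg_geometric; rewrite ger0_norm.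
by rewrite /geometric /= ltNge => /negP; apply; rewrite (le_trans (aK N))// ler_norm.
Qed.

Variables (u : R -> C) (rho : R).
Hypothesis uc : ccont u.
Hypothesis u_norm : forall t, `|u t| = rho%:C.
Hypothesis u_mean : forall n, (0 < n)%N -> cmean (fun t => u t ^+ n) = 0.

Lemma one_sub_bound (c : C) t : `|c| * rho%:C < 1 ->
  1 - `|c| * rho%:C <= `|1 - c * u t|.
Proof.
move=> c1; rewrite -(u_norm t) -normrM -[X in X - _](normr1 C).
exact: lerB_dist.
Qed.

Lemma one_sub_neq0 (c : C) t : `|c| * rho%:C < 1 -> 1 - c * u t != 0.
Proof.
move=> c1; rewrite -normr_gt0; apply: lt_le_trans (one_sub_bound t c1).
by rewrite subr_gt0.
Qed.

Lemma prod_one_sub_neq0 (cs : seq C) t : all (fun c => `|c| * rho%:C < 1) cs ->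
  \prod_(c <- cs) (1 - c * u t) != 0.
Proof.
elim: cs => [|c cs IH] /=; first by rewrite big_nil oner_neq0.
by case/andP=> c1 /IH ?; rewrite big_cons mulf_neq0 ?one_sub_neq0.
Qed.

Lemma ccont_one_sub (c : C) : ccont (fun t => 1 - c * u t).
Proof.
under eq_fun do rewrite -mulNr.
by apply: ccontD; [exact: ccont_cst|apply: ccontM => //; exact: ccont_cst].
Qed.

Lemma ccont_prodV (cs : seq C) : all (fun c => `|c| * rho%:C < 1) cs ->
  ccont (fun t => (\prod_(c <- cs) (1 - c * u t))^-1).
Proof.
move=> hcs; apply: ccontV => [t|]; first exact: prod_one_sub_neq0.
by apply: ccont_prod => c; exact: ccont_one_sub.
Qed.

Lemma prodV_bounded (cs : seq C) : all (fun c => `|c| * rho%:C < 1) cs ->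
  exists M : R, forall t, `|(\prod_(c <- cs) (1 - c * u t))^-1| <= M%:C.
Proof.
elim: cs => [|c cs IH] /=.
  by move=> _; exists 1 => t; rewrite big_nil invr1 normr1.
case/andP=> c1 /IH[M hM].
have cR : `|c| = (complex.Re `|c|)%:C by rewrite RRe_real ?normr_real.
exists ((1 - complex.Re `|c| * rho)^-1 * M) => t.
rewrite big_cons invfM normrM rmorphM ler_pM ?normr_ge0 ?hM//.
rewrite fmorphV rmorphB rmorphM rmorph1 /= -cR normfV lef_pV2 ?one_sub_bound//.
  by rewrite posrE normr_gt0 one_sub_neq0.
by rewrite posrE subr_gt0.
Qed.

(* The means [F n] satisfy [F n = (n == 0) + c F (n + 1)], and [c^j F (n + j)]
   tends to 0. *)
Lemma cmean_prodV (cs : seq C) n : all (fun c => `|c| * rho%:C < 1) cs ->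
  cmean (fun t => u t ^+ n / \prod_(c <- cs) (1 - c * u t)) = (n == 0)%:R.
Proof.
elim: cs n => [|c cs IH] n.
  move=> _; under eq_fun do rewrite big_nil divr1.
  by case: n => [|n]; [rewrite cmean_cst | exact: u_mean].
move=> hcs; have /andP[c1 hcs'] := hcs.
pose F n := cmean (fun t => u t ^+ n / \prod_(c <- c :: cs) (1 - c * u t)).
have Fc m : ccont (fun t => u t ^+ m / \prod_(c <- c :: cs) (1 - c * u t)).
  by apply: ccontM; [exact: ccontX|exact: ccont_prodV].
have FS m : F m = (m == 0)%:R + c * F m.+1.
  rewrite -(IH m hcs') /F -cmeanZ//.
  rewrite -cmeanD; last 2 first.
  - by apply: ccontM; [exact: ccontX|exact: ccont_prodV].
  - by apply: ccontM => //; exact: ccont_cst.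
  congr cmean; apply/funext=> t; rewrite !big_cons exprS.
  have := one_sub_neq0 t c1; have := prod_one_sub_neq0 t hcs'.
  by move=> p0 q0; field; apply/andP.
have FD m j : F m.+1 = c ^+ j * F (m.+1 + j)%N.
  elim: j => [|j IHj]; first by rewrite mul1r addn0.
  by rewrite IHj FS addSn /= add0r addnS exprSr mulrA.
have [M hM] := prodV_bounded hcs.
have cR : `|c| = (complex.Re `|c|)%:C by rewrite RRe_real ?normr_real.
have rho0 : 0 <= rho by rewrite -ler0c -(u_norm 0) normr_ge0.
have F0 m : F m.+1 = 0.
  apply/eqP; rewrite -normr_le0.
  have FR : `|F m.+1| = (complex.Re `|F m.+1|)%:C by rewrite RRe_real ?normr_real.
  rewrite FR -(rmorph0 (real_complex R)) lecR.
  apply: (@le0_geometric _ (2 * (rho ^+ m.+1 * M)) (complex.Re `|c| * rho)).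
    by rewrite -!lecR -ltcR rmorphM /= -cR mulr_ge0 ?normr_ge0 ?ler0c.
  move=> j; rewrite -lecR -FR {1}(FD m j) normrM normrX !(rmorphM, rmorphXn) /= cR.
  rewrite exprMn.
  have -> : 2%:C * (rho%:C ^+ m.+1 * M%:C) * ((complex.Re `|c|)%:C ^+ j * rho%:C ^+ j)
     = (complex.Re `|c|)%:C ^+ j * (2%:C * (rho%:C ^+ (m.+1 + j) * M%:C)).
    by rewrite exprD; ring.
  rewrite -cR ler_wpM2l ?exprn_ge0//.
  rewrite -rmorphXn -!rmorphM; apply: cmean_bound => // t.
  rewrite normrM normrX u_norm rmorphM rmorphXn ler_wpM2l ?exprn_ge0 ?ler0c//.
by rewrite -/(F n); case: n => [|n]; rewrite ?F0// FS F0 mulr0 addr0.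
Qed.

Lemma cmean_horner_prodV (p : {poly C}) (cs : seq C) :
  all (fun c => `|c| * rho%:C < 1) cs ->
  cmean (fun t => p.[u t] / \prod_(c <- cs) (1 - c * u t)) = p`_0.
Proof.
move=> hcs.
have -> : (fun t => p.[u t] / \prod_(c <- cs) (1 - c * u t)) =
  fun t => \sum_(i < size p) p`_i * (u t ^+ i / \prod_(c <- cs) (1 - c * u t)).
  apply/funext=> t; rewrite horner_coef mulr_suml; apply: eq_bigr => i _.
  by rewrite mulrA.
have Fc m : ccont (fun t => u t ^+ m / \prod_(c <- cs) (1 - c * u t)).
  by apply: ccontM; [exact: ccontX|exact: ccont_prodV].
rewrite cmean_sum; last by move=> i; apply: ccontM => //; exact: ccont_cst.
under eq_bigr do rewrite cmeanZ// cmean_prodV//.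
case: (posnP (size p)) => [s0|s0].
  by move/eqP: (s0); rewrite size_poly_eq0 => /eqP ->; rewrite size_poly0 big_ord0 coef0.
rewrite (bigD1 (Ordinal s0))//= mulr1 big1 ?addr0// => i i0.
by rewrite (negbTE (_ : (i != 0 :> nat))) ?mulr0.
Qed.

End GeometricMean.

Lemma cmean_lincomb (R : realType) (f0 f1 f2 g : R -> R[i]) (a b c : R[i]) :
  ccont f0 -> ccont f1 -> ccont f2 -> ccont g ->
  (forall t, c * g t = f0 t + (a * f1 t + b * f2 t)) ->
  c * cmean g = cmean f0 + (a * cmean f1 + b * cmean f2).
Proof.
move=> c0 c1 c2 cg e.
have cZ (d : R[i]) (f : R -> R[i]) : ccont f -> ccont (fun t => d * f t).
  by move=> fc; apply: ccontM => //; exact: ccont_cst.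
rewrite -cmeanZ//; under eq_fun do rewrite e.
have d1 := cZ a f1 c1; have d2 := cZ b f2 c2.
by rewrite (cmeanD c0 (ccontD d1 d2)) (cmeanD d1 d2) !cmeanZ.
Qed.

Section InnerIntegral.
Variables (R : realType) (r : R) (z : R[i]).
Local Notation C := R[i].
Hypothesis r0 : 0 < r.
Hypothesis z0 : z != 0.
Hypothesis zr : `|z| * r%:C < 1.
Hypothesis zVr : `|z^-1| * r%:C < 1.
Implicit Types (ys : seq C) (y : C).

Let W (t : R) : C := circle_pt r t.

Lemma ccont_W : ccont W. Proof. exact: ccont_circle. Qed.

Lemma W_neq0 t : W t != 0. Proof. exact: circle_pt_neq0. Qed.

Lemma W_norm t : `|W t| = r%:C. Proof. by rewrite norm_circle_pt// ltW. Qed.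

Lemma cmean_W n : (0 < n)%N -> cmean (fun t => W t ^+ n) = 0.
Proof.
move=> n0; under eq_fun do rewrite /W circle_ptX.
by apply: (@cmean_circle _ _ n%:Z); rewrite -lt0n.
Qed.

Lemma WV_norm t : `|(W t)^-1| = (r^-1)%:C.
Proof. by rewrite normfV W_norm fmorphV. Qed.

Lemma cmean_WV n : (0 < n)%N -> cmean (fun t => (W t)^-1 ^+ n) = 0.
Proof.
move=> n0; have -> : (fun t => (W t)^-1 ^+ n) = fun t => circle_pt (r^-1 ^+ n) ((- n%:Z)%:~R * t).
  by apply/funext=> t; rewrite /W circle_ptV// circle_ptX mulrNz mulNr mulrN.
by apply: cmean_circle; rewrite oppr_eq0 -lt0n.
Qed.

Lemma ccont_WV : ccont (fun t => (W t)^-1).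
Proof. by apply: ccontV; [exact: W_neq0|exact: ccont_W]. Qed.

Definition small ys := all (fun y => `|y| < r%:C) ys.

Let P ys (w : C) := \prod_(y <- ys) (w - y).
Let D (w : C) := (1 - w * z) * (1 - w * z^-1).

Lemma D_prod w : D w = \prod_(c <- [:: z; z^-1]) (1 - c * w).
Proof. by rewrite !big_cons big_nil mulr1 /D ![w * _]mulrC. Qed.

Lemma small_D : all (fun c => `|c| * r%:C < 1) [:: z; z^-1].
Proof. by rewrite /= zr zVr. Qed.

Lemma D_neq0 t : D (W t) != 0.
Proof. by rewrite D_prod; apply: prod_one_sub_neq0 W_norm _ _ small_D. Qed.

Lemma P_neq0 ys t : small ys -> P ys (W t) != 0.
Proof.
elim: ys => [|y ys IH]; first by rewrite /P big_nil oner_neq0.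
case/andP=> hy /IH h; rewrite /P big_cons mulf_neq0// subr_eq0.
by apply: contraTneq hy => <-; rewrite W_norm ltxx.
Qed.

Lemma ccont_P ys : ccont (fun t => P ys (W t)).
Proof.
apply: ccont_prod => y; under eq_fun do rewrite -[- y]mulN1r.
by apply: ccontD; [exact: ccont_W|exact: ccont_cst].
Qed.

Lemma ccont_D : ccont (fun t => D (W t)).
Proof.
under eq_fun do rewrite D_prod.
by apply: ccont_prod => c; apply: ccont_one_sub; exact: ccont_W.
Qed.

Lemma ccont_fraction ys m : small ys -> ccont (fun t => W t ^+ m / (P ys (W t) * D (W t))).
Proof.
move=> hs; apply: ccontM; first exact: ccontX ccont_W.
apply: ccontV => [t|]; first by rewrite mulf_neq0 ?P_neq0 ?D_neq0.
by apply: ccontM; [exact: ccont_P|exact: ccont_D].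
Qed.

Lemma cmean_outer ys y : small (y :: ys) ->
  cmean (fun t => W t / P (y :: ys) (W t)) = (ys == [::])%:R.
Proof.
move=> hs.
have -> : (fun t => W t / P (y :: ys) (W t)) =
  fun t => (W t)^-1 ^+ size ys / \prod_(c <- y :: ys) (1 - c * (W t)^-1).
  apply/funext=> t; have W0 := W_neq0 t.
  have -> : \prod_(c <- y :: ys) (1 - c * (W t)^-1) = P (y :: ys) (W t) * (W t)^-1 ^+ (size ys).+1.
    rewrite /P -[(size ys).+1]/(size (y :: ys)); elim: (y :: ys) => [|v vs IH].
      by rewrite !big_nil mulr1.
    rewrite !big_cons IH /= exprS.
    by field.
  rewrite exprS; move: (expf_neq0 (size ys) (invr_neq0 W0)).
  set v := _ ^+ size ys => v0; have p0 := P_neq0 t hs.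
  by field; rewrite v0 W0.
rewrite (cmean_prodV ccont_WV WV_norm cmean_WV).
  by rewrite size_eq0.
apply: sub_all hs => c hc; rewrite fmorphV /= ltr_pdivrMr ?mul1r//.
by rewrite ltcR.
Qed.

(* Induction based on [hpoly y = D - (w - y) (w + y - S)]. *)
Lemma cmean_reduction ys : small ys ->
  (\prod_(y <- ys) (hpoly y).[z + z^-1]) * cmean (fun t => W t ^+ 1 / (P ys (W t) * D (W t)))
    = (redpair ys).1.[z + z^-1] /\
  (\prod_(y <- ys) (hpoly y).[z + z^-1]) * cmean (fun t => W t ^+ 2 / (P ys (W t) * D (W t)))
    = (redpair ys).2.[z + z^-1] + (ys == [::])%:R.
Proof.
elim: ys => [_|y ys IH].
  have base m : cmean (fun t => W t ^+ m.+1 / (P [::] (W t) * D (W t))) = 0.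
    under eq_fun do rewrite /P big_nil mul1r D_prod.
    by rewrite (cmean_prodV ccont_W W_norm cmean_W _ small_D).
  by rewrite /= !base !mulr0 horner0 hornerN hornerC addNr.
move=> hys; have /andP[hy hs] := hys; have [IH1 IH2] := IH hs.
set S := z + z^-1 in IH1 IH2 *.
have e2 : cmean (fun t => W t ^+ 2 / (P (y :: ys) (W t) * D (W t))) =
  cmean (fun t => W t ^+ 1 / (P ys (W t) * D (W t))) +
  y * cmean (fun t => W t ^+ 1 / (P (y :: ys) (W t) * D (W t))).
  rewrite -cmeanZ; last exact: ccont_fraction.
  rewrite -cmeanD; last 2 first.
  - exact: ccont_fraction.
  - by apply: ccontM; [exact: ccont_cst|exact: ccont_fraction].
  congr cmean; apply/funext=> t; have := D_neq0 t; have := P_neq0 t hs; have := P_neq0 t hys.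
  rewrite /P !big_cons mulf_eq0 negb_or => /andP[h1 _] h2 h3.
  by field; rewrite h1 h2 h3.
have e1 : (hpoly y).[S] * cmean (fun t => W t ^+ 1 / (P (y :: ys) (W t) * D (W t))) =
  (ys == [::])%:R + (- cmean (fun t => W t ^+ 2 / (P ys (W t) * D (W t))) +
  (S - y) * cmean (fun t => W t ^+ 1 / (P ys (W t) * D (W t)))).
  have cf m := ccont_fraction m hs; have cf' m := ccont_fraction m hys.
  have cW : ccont (fun t => W t / P (y :: ys) (W t)).
    apply: ccontM; first exact: ccont_W.
    by apply: ccontV => [t|]; [exact: P_neq0|exact: ccont_P].
  rewrite -(cmean_outer hys) -mulN1r.
  apply: (cmean_lincomb cW (cf 2) (cf 1) (cf' 1)).
  move=> t; have := D_neq0 t; have := P_neq0 t hs; have := P_neq0 t hys.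
  rewrite /P !big_cons mulf_eq0 negb_or => /andP[h1 _] h2 h3.
  have -> : (hpoly y).[S] = D (W t) - (W t - y) * (W t + y - S).
    by rewrite /hpoly !hornerE /D /S; field.
  by field; rewrite h1 h2 h3.
rewrite redpair_cons /= !big_cons.
move: IH1 IH2 e1 e2; rewrite -/S.
set H := \prod_(_ <- _) _; set m1 := cmean _; set m2 := cmean _.
set n1 := cmean _; set n2 := cmean _ => IH1 IH2 e1 e2.
have He : H * (ys == [::])%:R = (ys == [::])%:R.
  by rewrite /H; case: (ys) => [|? ?]; rewrite ?big_nil ?mul1r// mulr0.
have E1 : (hpoly y).[S] * H * n1 = (('X - y%:P) * (redpair ys).1 - (redpair ys).2).[S].
  rewrite mulrAC e1 hornerD hornerN hornerM hornerXsubC -IH1.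
  rewrite -(addrK (ys == [::])%:R (redpair ys).2.[S]) -IH2 -[in RHS]He.
  by ring.
split=> //; rewrite addr0 e2 mulrDr [_ * (y * _)]mulrCA E1.
rewrite !(hornerD, hornerN, hornerM, hornerZ, hornerXsubC) -mulrA IH1 /hpoly !hornerE.
by ring.
Qed.

Variables (n : nat) (ys : seq C).
Hypothesis size_ys : size ys = n.
Hypothesis small_ys : small ys.
Hypothesis rr : r * r < 1.

Let Q (w : C) := (recip_poly ys).[w].

Lemma recip_prod w : Q w = \prod_(y <- ys) (1 - y * w).
Proof. exact: horner_recip_poly. Qed.

Lemma small_recip : all (fun c => `|c| * r%:C < 1) ys.
Proof.
apply: sub_all small_ys => y hy; apply: (@le_lt_trans _ _ (r * r)%:C); last by rewrite ltcR.
by rewrite rmorphM ler_wpM2r ?ltW// ltcR.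
Qed.

Lemma Q_neq0 t : Q (W t) != 0.
Proof. by rewrite recip_prod; apply: prod_one_sub_neq0 W_norm _ _ small_recip. Qed.

Lemma ccont_Q : ccont (fun t => Q (W t)).
Proof. exact: ccont_horner ccont_W. Qed.

Definition inner_mean (g : {poly C}) :=
  cmean (fun t => W t * g.[W t] / (P ys (W t) * (Q (W t) * D (W t)))).

Lemma ccont_inner (g : {poly C}) :
  ccont (fun t => W t * g.[W t] / (P ys (W t) * (Q (W t) * D (W t)))).
Proof.
apply: ccontM.
  by apply: ccontM; [exact: ccont_W|exact: ccont_horner ccont_W].
apply: ccontV => [t|]; first by rewrite mulf_neq0 ?P_neq0// mulf_neq0 ?Q_neq0 ?D_neq0.
apply: ccontM; first exact: ccont_P.
by apply: ccontM; [exact: ccont_Q|exact: ccont_D].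
Qed.

Lemma horner_newton i w : (newton ys i).[w] = P (take i ys) w.
Proof. by rewrite horner_prod; apply: eq_bigr => y _; rewrite hornerXsubC. Qed.

Lemma inner_mean_multiple q : inner_mean (newton ys n * q) = 0.
Proof.
have -> : inner_mean (newton ys n * q) =
  cmean (fun t => ('X * q).[W t] / \prod_(c <- ys ++ [:: z; z^-1]) (1 - c * W t)).
  congr cmean; apply/funext=> t; rewrite big_cat /= -recip_prod -D_prod.
  rewrite !hornerM hornerX horner_newton take_oversize ?size_ys//.
  have := P_neq0 t small_ys; have := Q_neq0 t; have := D_neq0 t.
  by move=> h1 h2 h3; field; rewrite h1 h2 h3.
rewrite (cmean_horner_prodV ccont_W W_norm cmean_W) ?coefXM//.
by rewrite all_cat small_recip small_D.
Qed.

Lemma inner_mean_newton g :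
  inner_mean g = \sum_(i < n) divdiff ys g i * inner_mean (newton ys i).
Proof.
have [q Hq] := newton_expansion ys g; rewrite size_ys in Hq.
have -> : inner_mean g = cmean (fun t => (\sum_(i < n) divdiff ys g i *
   (W t * (newton ys i).[W t] / (P ys (W t) * (Q (W t) * D (W t))))) +
   W t * (newton ys n * q).[W t] / (P ys (W t) * (Q (W t) * D (W t)))).
  congr cmean; apply/funext=> t; rewrite {1}Hq hornerD horner_sum mulrDr mulrDl.
  congr (_ + _); rewrite mulr_sumr mulr_suml; apply: eq_bigr => i _.
  by rewrite hornerZ !mulrA [W t * _]mulrC.
have cZ (i : 'I_n) : ccont (fun t => divdiff ys g i *
   (W t * (newton ys i).[W t] / (P ys (W t) * (Q (W t) * D (W t))))).
  by apply: ccontM; [exact: ccont_cst|exact: ccont_inner].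
rewrite cmeanD; [|by apply: ccont_sum => i; exact: cZ|exact: ccont_inner].
rewrite -/(inner_mean _) inner_mean_multiple addr0 cmean_sum//; apply: eq_bigr => i _.
by rewrite cmeanZ; last exact: ccont_inner.
Qed.

Let H := \prod_(y <- ys) (hpoly y).[z + z^-1].

Lemma inner_mean_recip i : H * inner_mean (recip_poly ys * newton ys i) = (cpoly ys i).[z + z^-1].
Proof.
have small_drop : small (drop i ys).
  by move: small_ys; rewrite -{1}(cat_take_drop i ys) /small all_cat => /andP[].
have [e _] := cmean_reduction small_drop.
rewrite /H -[X in \prod_(_ <- X) _](cat_take_drop i ys) big_cat /= /cpoly hornerM -e -mulrA.
rewrite horner_prod; congr (_ * (_ * _)).
congr cmean; apply/funext=> t; rewrite hornerM horner_newton -/(Q _) expr1.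
have := P_neq0 t small_drop; have := Q_neq0 t; have := D_neq0 t.
have := P_neq0 t small_ys; rewrite -[X in P X _](cat_take_drop i ys) /P big_cat /=.
rewrite mulf_eq0 negb_or => /andP[h0 _] h1 h2 h3.
by field; rewrite h0 h1 h2 h3.
Qed.

Lemma recip_neq0 y v : y \in ys -> v \in ys -> 1 - v * y != 0.
Proof.
move=> yI vI; rewrite subr_eq0 eq_sym; apply: contraTneq (_ : `|v * y| < 1) => [->|].
  by rewrite normr1 ltxx.
rewrite normrM; apply: le_lt_trans (allP small_recip _ vI).
by rewrite ler_wpM2l// ltW// (allP small_ys).
Qed.

Lemma inner_mean_kernel g : H * inner_mean g =
  \sum_(p < n) (\sum_(m < n) divdiff ys g m * kernel_mx n ys m p) * (z + z^-1) ^+ p.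
Proof.
pose u : 'cV[C]_n := \col_m (H * inner_mean (newton ys m)).
pose S : 'cV[C]_n := \col_p (z + z^-1) ^+ p.
have Mu : mul_mx n ys (recip_poly ys) \in unitmx.
  rewrite unitmxE unitfE det_mul_mx// prodf_seq_neq0; apply/allP => y yI /=.
  rewrite horner_recip_poly prodf_seq_neq0; apply/allP => v vI /=.
  exact: recip_neq0.
have uS : u = kernel_mx n ys *m S.
  apply: (can_inj (mulKmx Mu)); rewrite /kernel_mx -mulmxA mulKVmx//.
  apply/matrixP => i j; rewrite ord1 !mxE.
  transitivity (cpoly ys i).[z + z^-1].
    rewrite -inner_mean_recip inner_mean_newton mulr_sumr; apply: eq_bigr => m _.
    by rewrite !mxE mulrCA.
  rewrite (horner_coef_wide _ (n := n)); first by apply: eq_bigr => p _; rewrite !mxE.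
  by rewrite -[X in (_ <= X)%N]size_ys size_cpoly// size_ys ltnW.
rewrite inner_mean_newton mulr_sumr.
have um (m : 'I_n) : H * inner_mean (newton ys m) =
    \sum_(p < n) kernel_mx n ys m p * (z + z^-1) ^+ p.
  transitivity (u m 0); first by rewrite mxE.
  by rewrite uS mxE; apply: eq_bigr => p _; rewrite [S _ _]mxE.
under eq_bigr => m _ do rewrite mulrCA um mulr_sumr.
rewrite exchange_big; apply: eq_bigr => p _; rewrite mulr_suml.
by apply: eq_bigr => m _; rewrite mulrA.
Qed.

End InnerIntegral.

Section DoubleIntegral.
Variable R : realType.
Local Notation C := R[i].

Lemma cmean_laurent (r : R) (p : nat) (b : int) : 0 < r ->
  ccont (fun t => circle_pt r t ^ (- b) * (circle_pt r t + (circle_pt r t)^-1) ^+ p) /\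
  cmean (fun t => circle_pt r t ^ (- b) * (circle_pt r t + (circle_pt r t)^-1) ^+ p)
  = laurent_coef C p b.
Proof.
move=> r0; elim: p b => [|p IH] b.
  have -> : (fun t => circle_pt r t ^ (- b) * (circle_pt r t + (circle_pt r t)^-1) ^+ 0)
      = fun t => circle_pt (r ^ (- b)) ((- b)%:~R * t).
    by apply/funext=> t; rewrite expr0 mulr1 circle_ptXz.
  split; first exact: ccont_circle_pt.
  have [->|b0] := eqVneq b 0; last by rewrite cmean_circle ?oppr_eq0//= (negbTE b0).
  have -> : (fun t : R => circle_pt (r ^ (- 0)) ((- 0)%:~R * t)) = fun=> 1 :> C.
    by apply/funext=> t; rewrite oppr0 mul0r circle_pt0.
  by rewrite cmean_cst.
have [c1 e1] := IH (b - 1); have [c2 e2] := IH (b + 1).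
have -> : (fun t => circle_pt r t ^ (- b) * (circle_pt r t + (circle_pt r t)^-1) ^+ p.+1) =
  fun t => circle_pt r t ^ (- (b - 1)) * (circle_pt r t + (circle_pt r t)^-1) ^+ p +
  circle_pt r t ^ (- (b + 1)) * (circle_pt r t + (circle_pt r t)^-1) ^+ p.
  apply/funext=> t; have z0 := circle_pt_neq0 t r0.
  rewrite opprB opprD [1 - b]addrC !expfzDr// expr1z exprN1 exprS.
  by move: (_ ^+ p) (_ ^ (- b)) => q v; ring.
by split; [exact: ccontD|rewrite cmeanD// e1 e2].
Qed.

Definition gen_kernel k (N1 N2 : {poly C}) (y : 'I_k -> C) (rz rw : R) (a b : int) : C :=
  circle_integral rz (fun z => circle_integral rw (fun w =>
    N1.[z] * N2.[w] / ((1 - w * z) * (1 - w * z^-1)) * (Jfun y z / Jfun y w)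
    / ((2 * pi%:C * 'i%C) ^+ 2 * z ^ (b + 1) * w ^ (- a + 1)))).

Definition shifted_coef (N : {poly C}) (p : nat) (b : int) : C :=
  \sum_(s < size N) N`_s * laurent_coef C p (b - s%:Z).

Lemma Jfun_hpoly k (y : 'I_k -> C) z : z != 0 ->
  Jfun y z = \prod_(v <- rev_values y) (hpoly v).[z + z^-1].
Proof.
move=> z0; rewrite big_rev_values; apply: eq_bigr => i _.
by rewrite /hpoly !hornerE; field.
Qed.

Lemma Jfun_newton k (y : 'I_k -> C) w : w != 0 ->
  Jfun y w * w ^+ k = (\prod_(v <- rev_values y) (w - v)) * (recip_poly (rev_values y)).[w].
Proof.
move=> w0; rewrite horner_recip_poly !big_rev_values -[X in w ^+ X](card_ord k).
rewrite -prodr_const -!big_split; apply: eq_bigr => i _ /=.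
by field.
Qed.

Lemma gen_kernelE k (N1 N2 : {poly C}) (y : 'I_k -> C) (rz rw : R) (a b : int) (l : nat) :
  admissible_contours y rz rw -> a + k%:Z = l%:Z + 1 ->
  gen_kernel N1 N2 y rz rw a b =
  \sum_(p < k) (\sum_(m < k) divdiff (rev_values y) (N2 * 'X^l) m
                             * kernel_mx k (rev_values y) m p) * shifted_coef N1 p b.
Proof.
case=> rw0 rwz rzw hy al; have rz0 := lt_trans rw0 rwz.
have eab : - a + 1 = k%:Z - l%:Z by rewrite -[a](addrK k%:Z) al; ring.
set ys := rev_values y; pose g := N2 * 'X^l.
have sy : size ys = k by rewrite size_rev_values.
have smy : small rw ys by rewrite /small all_rev all_map; apply/allP => i _ /=.
have rww : rw * rw < 1 by rewrite (le_lt_trans _ rzw)// ler_wpM2r// ltW.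
pose c p := \sum_(m < k) divdiff ys g m * kernel_mx k ys m p.
pose kappa : C := (2 * pi%:C * 'i%C) ^+ 2.
have tp : (2 * pi)%:C = 2 * pi%:C :> C by rewrite rmorphM rmorph_nat.
have i2 : 'i%C ^+ 2 = -1 :> C by exact: sqr_i.
have p0 : 2 * pi%:C != 0 :> C by rewrite -tp twopiC_neq0.
have kE : kappa = - (2 * pi%:C) ^+ 2 by rewrite /kappa exprMn i2 mulrN1.
have innerE t : let z := circle_pt rz t in
  circle_integral rw (fun w =>
    N1.[z] * N2.[w] / ((1 - w * z) * (1 - w * z^-1)) * (Jfun y z / Jfun y w)
    / (kappa * z ^ (b + 1) * w ^ (- a + 1))) * ('i%C * z)
  = (2 * pi)%:C^-1 * (N1.[z] * (z ^ (- b) * \sum_(p < k) c p * (z + z^-1) ^+ p)).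
  move=> z; have z0 : z != 0 := circle_pt_neq0 t rz0.
  have zn : `|z| = rz%:C by rewrite norm_circle_pt// ltW.
  have zr : `|z| * rw%:C < 1 by rewrite zn -rmorphM ltcR.
  have zVr : `|z^-1| * rw%:C < 1.
    by rewrite normfV zn mulrC ltr_pdivrMr ?mul1r ?ltcR.
  have := inner_mean_kernel rw0 z0 zr zVr sy smy rww g.
  rewrite -/ys -Jfun_hpoly// -/c => <-.
  pose K1 := N1.[z] * Jfun y z / (kappa * z ^ (b + 1)) * 'i%C.
  have -> : circle_integral rw (fun w =>
    N1.[z] * N2.[w] / ((1 - w * z) * (1 - w * z^-1)) * (Jfun y z / Jfun y w)
    / (kappa * z ^ (b + 1) * w ^ (- a + 1))) = K1 * ((2 * pi)%:C * inner_mean rw z ys g).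
    rewrite /inner_mean /cmean [(2 * pi)%:C * _]mulrC mulfVK ?twopiC_neq0//.
    rewrite -complex_integralZ; last exact: ccont_inner.
    congr complex_integral; apply/funext=> s; set w := circle_pt rw s.
    have w0 : w != 0 := circle_pt_neq0 s rw0.
    have Jw := Jfun_newton y w0.
    have wa : w ^ (- a + 1) = w ^+ k / w ^+ l.
      by rewrite eab expfzDr// exprnN.
    rewrite [(\prod_(_ <- _) _) * _]mulrA -Jw wa hornerM hornerXn /K1 !invfM !invrK.
    ring.
  have zb0 : z ^ b != 0 by rewrite expfz_neq0.
  transitivity (N1.[z] * Jfun y z * inner_mean rw z ys g * 'i%C ^+ 2 *
    ((2 * pi)%:C * z / (kappa * z ^ (b + 1)))); first by rewrite /K1; ring.
  rewrite i2 kE expfzDr// expr1z -invr_expz tp.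
  have -> : 2 * pi%:C * z / (- (2 * pi%:C) ^+ 2 * (z ^ b * z)) = - ((2 * pi%:C)^-1 / z ^ b).
    by move: (2 * pi%:C) (z ^ b) p0 zb0 => u v u0 v0; field; rewrite u0 v0 z0.
  ring.
pose h (t : R) := let z := circle_pt rz t in
  N1.[z] * (z ^ (- b) * \sum_(p < k) c p * (z + z^-1) ^+ p).
have hE : h = fun t => \sum_(p < k) \sum_(s < size N1) (c p * N1`_s) *
    (circle_pt rz t ^ (- (b - s%:Z)) * (circle_pt rz t + (circle_pt rz t)^-1) ^+ p).
  apply/funext=> t; rewrite /h; have z0 := circle_pt_neq0 t rz0.
  rewrite horner_coef !mulr_sumr; apply: eq_bigr => p _.
  rewrite mulr_suml; apply: eq_bigr => s _.
  by rewrite opprB expfzDr// -exprnP; ring.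
have cL (p : 'I_k) (s : 'I_(size N1)) : ccont (fun t => (c p * N1`_s) *
    (circle_pt rz t ^ (- (b - s%:Z)) * (circle_pt rz t + (circle_pt rz t)^-1) ^+ p)).
  by apply: ccontM; [exact: ccont_cst|case: (cmean_laurent p (b - s%:Z) rz0)].
have ch : ccont h by rewrite hE; apply: ccont_sum => p; apply: ccont_sum => s.
transitivity (cmean h).
  transitivity (complex_integral `[0, 2 * pi]%classic (fun t => (2 * pi)%:C^-1 * h t)).
    by congr complex_integral; apply/funext=> t; exact: innerE.
  by rewrite complex_integralZ// mulrC.
rewrite hE cmean_sum; last by move=> p; apply: ccont_sum.
apply: eq_bigr => p _; rewrite cmean_sum// mulr_sumr; apply: eq_bigr => s _.
have [cc ce] := cmean_laurent p (b - s%:Z) rz0.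
by rewrite cmeanZ// ce mulrA.
Qed.

End DoubleIntegral.

(** * The kernels *)

Section KernelDeterminants.
Variable R : realType.
Local Notation C := R[i].

Lemma contour_norm k (y : 'I_k -> C) (rz rw : R) i j :
  admissible_contours y rz rw -> `|y i * y j| < 1.
Proof.
move=> [rw0 rwz rzw hy]; rewrite normrM; apply: (@le_lt_trans _ _ (rw * rw)%:C).
  by rewrite rmorphM ler_pM ?normr_ge0 ?ltW.
by rewrite ltcR (le_lt_trans _ rzw)// ler_wpM2r// ltW.
Qed.

Lemma contour_neq0 k (y : 'I_k -> C) (rz rw : R) i :
  admissible_contours y rz rw -> 1 - y i ^+ 2 != 0.
Proof.
move=> hadm; rewrite subr_eq0 eq_sym expr2.
by apply: contraTneq (contour_norm i i hadm) => ->; rewrite normr1 ltxx.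
Qed.

Lemma det_gen_kernel k (N1 N2 : {poly C}) (y : 'I_k -> C) (rz rw : R) lam :
  admissible_contours y rz rw -> weakly_decreasing lam -> size lam = k ->
  \det (\matrix_(i < k, j < k) gen_kernel N1 N2 y rz rw (npos lam i) (npos lam j)) =
  schur lam y * (\prod_(i < k) N2.[y i])
  / ((\prod_(i < k) (1 - y i ^+ 2)) * \prod_(i < k) \prod_(j < k | (i < j)%N) (1 - y i * y j))
  * \det (\matrix_(p < k, j < k) shifted_coef N1 p (npos lam j)).
Proof.
move=> hadm dl sl.
have sy : size (rev_values y) = k by rewrite size_rev_values.
rewrite -det_kernel_factorization//; first last.
- move=> i; rewrite addrC -[1]opprK subr_eq0 expr2.
  by apply: contraTneq (contour_norm i i hadm) => ->; rewrite normrN1 ltxx.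
- move=> i j; rewrite subr_eq0 eq_sym.
  by apply: contraTneq (contour_norm i j hadm) => ->; rewrite normr1 ltxx.
congr (\det _); apply/matrixP => i j.
rewrite mxE (gen_kernelE _ _ _ (l := (nth 0%N lam i + (k.-1 - i))%N) hadm); last first.
  by rewrite /npos; have := ltn_ord i; lia.
rewrite [RHS]mxE; apply: eq_bigr => p _; congr (_ * _); last by rewrite mxE.
rewrite [RHS]mxE; apply: eq_bigr => m _; congr (_ * _).
rewrite [RHS]mxE divdiff_mul ?sy//; apply: eq_bigr => q _.
by rewrite !mxE.
Qed.

Lemma shifted_coef_wide (N : {poly C}) p b n : (size N <= n)%N ->
  shifted_coef N p b = \sum_(s < n) N`_s * laurent_coef C p (b - s%:Z).
Proof.
move=> hn; rewrite /shifted_coef (big_ord_widen _ (fun s => N`_s * laurent_coef C p (b - s%:Z)) hn).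
rewrite big_mkcond; apply: eq_bigr => s _; case: ltnP => // hs.
by rewrite nth_default// mul0r.
Qed.

Lemma det_base_columns k (phi : nat -> int -> C) :
  (forall p j : nat, (p < j)%N -> phi p (- j%:Z) = 0) -> (forall p : nat, phi p (- p%:Z) = 1) ->
  \det (\matrix_(p < k, j < k) phi p (- j%:Z)) = 1.
Proof.
move=> h0 h1; rewrite det_trig; last by apply/is_trig_mxP => i j ij; rewrite mxE h0.
by rewrite big1// => i _; rewrite mxE h1.
Qed.

Lemma sumn_decreasing0 lam : nth 0%N lam 0 = 0%N -> weakly_decreasing lam -> sumn lam = 0%N.
Proof.
move=> l0 dl; rewrite sumnE (big_nth 0%N) big1// => i _.
by have := weakly_decreasing_nth dl (leq0n i); rewrite l0 leqn0 => /eqP.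
Qed.

Lemma sqr_imag n : ('i%C : C) ^+ n * (- 'i%C) ^+ n = 1.
Proof. by rewrite -exprMn mulrN -expr2 sqr_i opprK expr1n. Qed.

Lemma imag_double n : (- 'i%C : C) ^+ (n + n) = (-1) ^+ n.
Proof. by rewrite exprD -exprMn mulrNN -expr2 sqr_i. Qed.

Lemma shifted_coefC p b :
  shifted_coef (1 - 'X^2) p b = laurent_coef C p b - laurent_coef C p (b - 2).
Proof.
rewrite (@shifted_coef_wide _ _ _ 3); last first.
  by rewrite (leq_trans (size_polyD _ _))// size_polyN size_polyXn size_poly1.
rewrite !big_ord_recl big_ord0 /= !coefB !coef1 !coefXn /= !subr0 sub0r.
by rewrite mul1r mul0r mulN1r add0r addr0.
Qed.

Lemma shifted_coefB p b :
  shifted_coef (1 - 'X) p b = laurent_coef C p b - laurent_coef C p (b - 1).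
Proof.
rewrite (@shifted_coef_wide _ _ _ 2); last first.
  by rewrite (leq_trans (size_polyD _ _))// size_polyN size_polyX size_poly1.
rewrite !big_ord_recl big_ord0 /= !coefB !coef1 !coefX /= !subr0 sub0r.
by rewrite mul1r mulN1r addr0.
Qed.

Lemma shifted_coefD p b : shifted_coef 1 p b = laurent_coef C p b.
Proof.
rewrite (@shifted_coef_wide _ _ _ 1) ?size_poly1// big_ord1 coef1 /=.
by rewrite mul1r subr0.
Qed.

Lemma columnsC k lam : weakly_decreasing lam -> size lam = k -> content_balance lam 1 ->
  \det (\matrix_(p < k, j < k) shifted_coef (1 - 'X^2) p (npos lam j)) = (- 'i%C : C) ^+ sumn lam.
Proof.
move=> dl sl hd.
rewrite (@det_column_reduction C (-1) 1 k (fun p b => shifted_coef (1 - 'X^2) p b)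
  (fun mu => (- 'i%C) ^+ sumn mu))//.
- rewrite (@det_base_columns k (fun p b => shifted_coef (1 - 'X^2) p b)) ?mulr1//.
    move=> p j pj; rewrite shifted_coefC -opprD !laurent_coefN !laurent_coef_gt ?subrr//; lia.
  move=> p; rewrite shifted_coefC -opprD !laurent_coefN laurent_coef_diag.
  by rewrite laurent_coef_gt ?subr0//; lia.
- move=> p b; rewrite !shifted_coefC mulN1r opprB -[laurent_coef _ _ (b - 2)]laurent_coefN.
  rewrite -[laurent_coef _ _ b]laurent_coefN; congr (laurent_coef _ _ _ - laurent_coef _ _ _).
    by rewrite opprB.
  by ring.
- by move=> mu m0 dm; rewrite sumn_decreasing0.
- move=> mu dm m0 hb; have := hb 0%N m0.
  have c0 : (0 < conj_part mu 0)%N by rewrite lt_conj_part.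
  rewrite sumn_unhook//; case: (conj_part mu 0) c0 => // c _ /= e.
  have -> : nth 0%N mu 0 = c.+2 by move: (nth _ _ _) e => p; clear; lia.
  have -> : (sumn (unhook mu) + c.+2 + c = c.+1 + c.+1 + sumn (unhook mu))%N by lia.
  by rewrite exprD imag_double exprS.
Qed.

Lemma columnsD k lam : weakly_decreasing lam -> size lam = k -> content_balance lam (-1) ->
  \det (\matrix_(p < k, j < k) shifted_coef 1 p (npos lam j)) = (- 'i%C : C) ^+ sumn lam.
Proof.
move=> dl sl hd.
rewrite (@det_column_reduction C 1 (-1) k (fun p b => shifted_coef 1 p b)
  (fun mu => (- 'i%C) ^+ sumn mu))//.
- rewrite (@det_base_columns k (fun p b => shifted_coef 1 p b)) ?mulr1//.
    by move=> p j pj; rewrite shifted_coefD laurent_coefN laurent_coef_gt.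
  by move=> p; rewrite shifted_coefD laurent_coefN laurent_coef_diag.
- by move=> p b; rewrite !shifted_coefD mul1r addNr sub0r laurent_coefN.
- by move=> mu m0 dm; rewrite sumn_decreasing0.
- move=> mu dm m0 hb; have := hb 0%N m0.
  have c0 : (0 < conj_part mu 0)%N by rewrite lt_conj_part.
  rewrite sumn_unhook//; case: (conj_part mu 0) c0 => // c _ /= e.
  have -> : nth 0%N mu 0 = c by move: (nth _ _ _) e => p; clear; lia.
  have -> : (sumn (unhook mu) + c + c = c + c + sumn (unhook mu))%N by lia.
  by rewrite exprD imag_double mul1r.
Qed.

Lemma columnsB k lam : weakly_decreasing lam -> size lam = k -> content_balance lam 0 ->
  \det (\matrix_(p < k, j < k) shifted_coef (1 - 'X) p (npos lam j))
  = (-1 : C) ^+ ((sumn lam + frob_rank lam) %/ 2).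
Proof.
move=> dl sl hd.
rewrite (@det_column_reduction C (-1) 0 k (fun p b => shifted_coef (1 - 'X) p b)
  (fun mu => (-1) ^+ ((sumn mu + frob_rank mu) %/ 2)))//.
- rewrite (@det_base_columns k (fun p b => shifted_coef (1 - 'X) p b)) ?mulr1//.
    by move=> p j pj; rewrite shifted_coefB -opprD !laurent_coefN !laurent_coef_gt ?subrr//; lia.
  move=> p; rewrite shifted_coefB -opprD !laurent_coefN laurent_coef_diag.
  by rewrite laurent_coef_gt ?subr0//; lia.
- move=> p b; rewrite !shifted_coefB mulN1r opprB -[laurent_coef _ _ (b - 1)]laurent_coefN.
  rewrite -[laurent_coef _ _ b]laurent_coefN; congr (laurent_coef _ _ _ - laurent_coef _ _ _).
    by rewrite opprB add0r.
  by ring.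
- move=> mu m0 dm; rewrite sumn_decreasing0// add0n.
  case E : (frob_rank mu) => [|r]//; have := lt_frob_rank 0 dm.
  by rewrite E m0.
- move=> mu dm m0 hb; have := hb 0%N m0.
  have c0 : (0 < conj_part mu 0)%N by rewrite lt_conj_part.
  rewrite sumn_unhook// frob_rank_unhook//; case: (conj_part mu 0) c0 => // c _ /= e.
  have -> : nth 0%N mu 0 = c.+1 by move: (nth _ _ _) e => p; clear; lia.
  have -> : (sumn (unhook mu) + c.+1 + c + (frob_rank (unhook mu)).+1
    = c.+1 * 2 + (sumn (unhook mu) + frob_rank (unhook mu)))%N by lia.
  by rewrite divnMDl// exprD exprS.
Qed.

Lemma kernelC_gen k (x : 'I_k -> C) (rz rw : R) a b :
  kernelC x rz rw a b = gen_kernel (1 - 'X^2) 1 (fun i => 'i%C * x i) rz rw a b.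
Proof.
congr circle_integral; apply/funext=> z; congr circle_integral; apply/funext=> w.
by rewrite !hornerE.
Qed.

Lemma kernelD_gen k (x : 'I_k -> C) (rz rw : R) a b :
  kernelD x rz rw a b = gen_kernel 1 (1 - 'X^2) (fun i => 'i%C * x i) rz rw a b.
Proof.
congr circle_integral; apply/funext=> z; congr circle_integral; apply/funext=> w.
by rewrite !hornerE.
Qed.

Lemma kernelB_gen k (x : 'I_k -> C) (rz rw : R) a b :
  kernelB x rz rw a b = gen_kernel (1 - 'X) (1 + 'X) x rz rw a b.
Proof.
congr circle_integral; apply/funext=> z; congr circle_integral; apply/funext=> w.
by rewrite !hornerE.
Qed.

Lemma admissible_rotation k (x : 'I_k -> C) rz rw :
  admissible_contours x rz rw -> admissible_contours (fun i => 'i%C * x i) rz rw.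
Proof.
by case=> ? ? ? h; split=> // i; rewrite normrM complexiE normCi mul1r.
Qed.

Lemma rotationM (x y : C) : ('i%C * x) * ('i%C * y) = - (x * y).
Proof. by rewrite mulrACA -expr2 sqr_i mulN1r. Qed.

End KernelDeterminants.

Local Close Scope complex_scope.

Theorem theorem1p1 (R : realType) (k : nat) (x : 'I_k -> R[i]) (rz rw : R)
    (hcont : admissible_contours x rz rw)
    (lam : k.-tuple nat) (hlam : sorted geq lam) :
  (typeC lam ->
     frakM_C x lam
     = \det (\matrix_(i < k, j < k) kernelC x rz rw (npos lam i) (npos lam j)))
  /\
  (typeD lam ->
     frakM_D x lam
     = \det (\matrix_(i < k, j < k) kernelD x rz rw (npos lam i) (npos lam j)))
  /\
  (typeB lam ->
     frakM_B x lam
     = \det (\matrix_(i < k, j < k) kernelB x rz rw (npos lam i) (npos lam j))).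
Proof.
have dl := sorted_weakly_decreasing hlam; have sl := size_tuple lam.
have hrot := admissible_rotation hcont; pose y i := 'i%C * x i.
have den : \prod_(i < k) \prod_(j < k | (i < j)%N) (1 - y i * y j) =
    \prod_(i < k) \prod_(j < k | (i < j)%N) (1 + x i * x j).
  by apply: eq_bigr => i _; apply: eq_bigr => j _; rewrite rotationM opprK.
split; [|split] => ht.
- under eq_mx do rewrite kernelC_gen.
  rewrite (det_gen_kernel _ _ hrot dl sl) (columnsC R dl sl (typeC_balance dl ht)).
  rewrite schur_scale// -/y den [\prod_(i < k) _.[_]]big1 => [|i _]; last by rewrite hornerC.
  rewrite mulr1 /frakM_C.
  have -> : \prod_(i < k) \prod_(j < k | (i <= j)%N) (1 + x i * x j) =
    \prod_(i < k) (1 - y i ^+ 2) * \prod_(i < k) \prod_(j < k | (i < j)%N) (1 + x i * x j).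
    rewrite -big_split; apply: eq_bigr => i _; rewrite (bigD1 i)//= expr2 rotationM opprK.
    by congr (_ * _); apply: eq_bigl => j; rewrite ltn_neqAle eq_sym andbC.
  rewrite -[LHS]mul1r -(sqr_imag R (sumn lam)).
  ring.
- under eq_mx do rewrite kernelD_gen.
  rewrite (det_gen_kernel _ _ hrot dl sl) (columnsD R dl sl (typeD_balance dl ht)).
  rewrite schur_scale// -/y den.
  rewrite [\prod_(i < k) _.[_]](eq_bigr (fun i => 1 - y i ^+ 2)) => [|i _]; last first.
    by rewrite !hornerE.
  have y0 : \prod_(i < k) (1 - y i ^+ 2) != 0.
    apply/prodf_neq0 => i _; exact: (contour_neq0 i hrot).
  rewrite invfM mulrA mulfK// /frakM_D -[LHS]mul1r -(sqr_imag R (sumn lam)).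
  ring.
- under eq_mx do rewrite kernelB_gen.
  rewrite (det_gen_kernel _ _ hcont dl sl) (columnsB R dl sl (typeB_balance dl ht)).
  rewrite [\prod_(i < k) _.[_]](eq_bigr (fun i => 1 + x i)) => [|i _]; last first.
    by rewrite !hornerE.
  have -> : \prod_(i < k) (1 - x i ^+ 2) = \prod_(i < k) (1 - x i) * \prod_(i < k) (1 + x i).
    by rewrite -big_split; apply: eq_bigr => i _; rewrite -[X in X - _](expr1n _ 2) subr_sqr.
  have x0 : \prod_(i < k) (1 + x i) != 0.
    apply/prodf_neq0 => i _; apply: contraNneq (contour_neq0 i hcont) => h.
    by rewrite -[X in X - _](expr1n _ 2) subr_sqr h mulr0.
  rewrite /frakM_B; move: (\prod_(i < k) _) x0 => u u0.
  rewrite !invfM.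
  transitivity ((-1) ^+ ((sumn lam + frob_rank lam) %/ 2) * (u / u) * schur lam x *
     ((\prod_(i < k) (1 - x i))^-1 * (\prod_(i < k) \prod_(j < k | (i < j)%N) (1 - x i * x j))^-1)).
    by rewrite divff// mulr1.
  ring.
Qed.
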